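(* Let $\lambda,\mu$ be two partitions and $k\in\mathbb{N}$. The coefficient of $s_\mu$ in the Schur expansion of $\kappa^k_{\infty,\infty}(s_\lambda)$ equals the number of pairs $(\mathbf{S},\mathbf{T})$ of lattice $k$-multi-tableaux of the same (arbitrary) $k$-multi-shape, such that $\mathbf{S}$ has content $\lambda$ and $\mathbf{T}$ has content $\mu$.
   Context: $s_\lambda$ denotes the Schur function. The $k$-fold map $\kappa^k_{\infty,\infty}$ on symmetric functions over $\mathbb{C}$ in infinitely many variables is the substitution $f\mapsto f[k\mathbf{y}_\infty]$, where $k\mathbf{y}_\infty$ is the alphabet $y_1,\dots,y_1,y_2,\dots,y_2,\dots$ with each variable repeated $k$ times; equivalently, the algebra homomorphism with $p_n\mapsto k\,p_n$ on power sums ($n\ge1$). A $k$-multi-tableau is a $k$-tuple $\mathbf{T}=(T^{(1)},\dots,T^{(k)})$ of semistandard Young tableaux (of possibly empty partition shapes, entries in the positive integers, drawn in English notation: rows weakly increasing, columns strictly increasing downwards). Its $k$-multi-shape is the $k$-tuple of partitions $(\nu^{(1)},\dots,\nu^{(k)})$ with $\nu^{(i)}$ the shape of $T^{(i)}$. The content of a tableau is the sequence whose $j$th entry is the number of entries equal to $j$; the content of $\mathbf{T}$ is the entrywise sum of the contents of the $T^{(i)}$. The word of $\mathbf{T}$ is the concatenation $w(T^{(1)})\cdots w(T^{(k)})$, where $w(T)$ is the row reading word, reading each row from left to right, starting with the bottom row and ending with the top row. $\mathbf{T}$ is lattice if its word is a (reverse) lattice word: for every $i\ge1$, every suffix of the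 word contains at least as many $i$'s as $(i+1)$'s. *)

(* Defs.v *)
From HB Require Import structures.
From mathcomp Require Import all_boot all_order all_algebra finmap.
From mathcomp Require Import boolp classical_sets functions cardinality fsbigop.
From mathcomp Require Import reals complex.

Set Implicit Arguments.
Unset Strict Implicit.
Unset Printing Implicit Defensive.

Import GRing.Theory.
Local Open Scope ring_scope.
Local Open Scope classical_set_scope.

(* Meaningful for finite sets only: fset_set sends an infinite set to fset0.  *)
Definition numel (T : choiceType) (A : set T) : nat := #|` fset_set A|.

Definition is_intpart (s : seq nat) : bool := sorted geq s && (0%N \notin s).

Definition intpart := {s : seq nat | is_intpart s}.

(* Tableaux are given by their rows, from top to bottom (English notation).   *)

Definition above (r s : seq nat) : bool :=
  all (fun c => nth 0 r c < nth 0 s c)%N (iota 0 (size s)).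

Definition is_ssyt (t : seq (seq nat)) : bool :=
  [&& is_intpart (map size t),
      all (all (fun x => 0 < x)%N) t,
      all (sorted leq) t
    & sorted above t].

Definition tableau := {t : seq (seq nat) | is_ssyt t}.

Definition shape (t : tableau) : seq nat := map size (val t).

(* [content t j] is the number of entries equal to j.+1: sequences are        *)
(* indexed from 0, whereas the entries of tableaux start at 1.                *)
Definition content (t : tableau) (j : nat) : nat :=
  count_mem j.+1 (flatten (val t)).

Definition row_word (t : tableau) : seq nat := flatten (rev (val t)).

Definition multi_shape k (T : k.-tuple tableau) : k.-tuple (seq nat) :=
  map_tuple shape T.

Definition multi_content k (T : k.-tuple tableau) (j : nat) : nat :=
  (\sum_(i < k) content (tnth T i) j)%N.

Definition multi_word k (T : k.-tuple tableau) : seq nat :=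
  flatten (map row_word T).

Definition lattice_word (w : seq nat) : Prop :=
  forall i n, (0 < i)%N ->
    (count_mem i.+1 (drop n w) <= count_mem i (drop n w))%N.

Definition lattice k (T : k.-tuple tableau) : Prop :=
  lattice_word (multi_word T).

Definition has_content k (T : k.-tuple tableau) (la : intpart) : Prop :=
  forall j, multi_content T j = nth 0%N (val la) j.

Definition lattice_pairs k (la mu : intpart) :
    set (k.-tuple tableau * k.-tuple tableau) :=
  [set ST | [/\ lattice ST.1, lattice ST.2,
                multi_shape ST.1 = multi_shape ST.2,
                has_content ST.1 la & has_content ST.2 mu]].
Arguments lattice_pairs : clear implicits.

(* Symmetric functions live among the formal series in x_0, x_1, x_2, ...; a  *)
(* series is given by its coefficients, a monomial by its exponents.          *)

Definition monomial := {fsfun nat -> nat with 0%N}.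

Definition series (K : Type) := monomial -> K.

Definition schur (K : pzSemiRingType) (la : intpart) : series K :=
  fun a => (numel [set t : tableau |
    shape t = val la /\ forall j, content t j = a j])%:R.

(* The monomials that become y^b when each x_n is replaced by y_m if          *)
(* [v n = Some m], and by 0 if [v n = None].                                  *)
Definition subst_fiber (v : nat -> option nat) (b : monomial) : set monomial :=
  [set a : monomial | (forall n, v n = None -> a n = 0%N) /\
           (forall m, b m = (\sum_(n <- finsupp a | v n == Some m) a n)%N)].

(* Well defined when each variable occurs finitely often in v, since then the *)
(* fibers are finite.                                                         *)
Definition subst (K : pzSemiRingType) (v : nat -> option nat) (f : series K) :
    series K :=
  fun b => \sum_(a \in subst_fiber v b) f a.

(* y_0, ..., y_0, y_1, ..., y_1, ... (k times each); no variable if k = 0.    *)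
Definition kfold_alphabet (k n : nat) : option nat :=
  if (0 < k)%N then Some (n %/ k)%N else None.

Definition kappa (K : pzSemiRingType) (k : nat) (f : series K) : series K :=
  subst (kfold_alphabet k) f.

Definition schur_expansion (K : pzSemiRingType) (f : series K)
    (c : {fsfun intpart -> K with 0}) : Prop :=
  forall a, f a = \sum_(nu <- finsupp c) c nu * schur K nu a.

(* Main.v *)
Require Import Defs.
From mathcomp Require Import all_boot all_order all_algebra finmap.
From mathcomp Require Import fingroup perm.
From mathcomp Require Import boolp classical_sets functions cardinality fsbigop.
From mathcomp Require Import reals complex.
From mathcomp Require Import zify ring.

Set Implicit Arguments.
Unset Strict Implicit.
Unset Printing Implicit Defensive.

Import Order.TTheory GRing.Theory Num.Theory.

(** A tableau is recorded by the matrix whose entry in row r and column j is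
    the number of letters j+1 in its row r.  Strictness of the columns then
    says that partial sums of consecutive rows interlace ([interlaced]), and
    the lattice condition on the word is the same condition on the transposed
    matrix.  A multi-tableau with k components becomes a matrix with k * n
    rows, interlaced inside each block of n rows.  All the numbers in the
    theorem are thus cardinals [num_adm] of sets of matrices with prescribed
    row sums and column sums, whose rows and columns interlace inside given
    blocks; transposition exchanges tableaux and lattice words.

    Two columns i, i+1 of an interlacing matrix can be toggled (Bender and
    Knuth): with the other columns fixed, each entry of column i ranges over
    an interval, inside which it is reflected.  Toggling all the rows shows that
    [num_adm] is symmetric in the column sums ([num_adm_tperm]).  Toggling only
    the rows from the first violation of the lattice condition on is a
    sign-reversing involution, in the style of Gasharov and Stembridge, so that
    the number of lattice matrices with column sums la is an alternating sum,
    over the permutations preserving the blocks, of numbers of matrices without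
    lattice condition ([alternant_num_adm]).  Since a symmetric function
    with bounded support is determined by these alternating sums
    ([alternant_vanish]), every [num_adm] is a sum over nu of the number of
    lattice matrices with column sums nu, times the number of tuples of
    tableaux of shapes nu ([num_adm_expansion]).  With a single block this is
    the Littlewood-Richardson rule for the product of the s_(nu^(i)); with k
    blocks and no condition on the rows, it is the k-th power of the Cauchy
    identity.

    These two cases give the theorem ([fold_expansion]).  The coefficient of y^a
    in the image of s_la counts lattice matrices with k * n rows, column sums
    la, and row sums that add up to a over the copies of each variable.
    Written as an alternating sum over the column sums, it involves matrices
    without condition on the rows, which may be regrouped into k blocks of n
    rows.  The Cauchy identity expands each term over the multi-shapes nu;
    summing again, the alternating sum yields the number of lattice
    multi-tableaux of shape nu and content la, and the sum over the copies of
    the variables yields the number of multi-tableaux of shape nu and content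
    a, to which the Littlewood-Richardson rule applies.

    The expansion is unique because Schur functions are triangular with respect
    to monomials ([schur_expansion_uniq]). *)

(** * Toggling one column of an interlacing matrix *)

Local Open Scope nat_scope.

Implicit Types (m : nat -> nat -> nat).

Definition psum m r j : nat := \sum_(i < j) m r i.

Definition tr m : nat -> nat -> nat := fun r i => m i r.

(** For the matrix of two weakly increasing rows of letters, where column i
    counts the letter i+1: each letter of row r+1 that is at most j+1 has to
    lie below a letter of row r that is at most j. *)
Definition interlaced m r : Prop :=
  forall j, psum m r.+1 j.+1 <= psum m r j.

Lemma psum0 m r : psum m r 0 = 0.
Proof. by rewrite /psum big_ord0. Qed.

Lemma psumS m r j : psum m r j.+1 = psum m r j + m r j.
Proof. by rewrite /psum big_ord_recr. Qed.

Lemma eq_psum m m' r j :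
  (forall i, i < j -> m r i = m' r i) -> psum m r j = psum m' r j.
Proof. by move=> e; apply: eq_bigr => i _; apply: e. Qed.

Lemma psum_stable m r K j :
  (forall i, K <= i -> m r i = 0) -> K <= j -> psum m r j = psum m r K.
Proof.
move=> m0; elim: j => [|j IH]; first by rewrite leqn0 => /eqP ->.
rewrite leq_eqVlt => /predU1P[-> //|]; rewrite ltnS => Kj.
by rewrite psumS IH // m0 // addn0.
Qed.

Section Toggle.

Variables (I : nat -> bool) (i r0 delta : nat).

Definition pairsum m r := m r i + m r i.+1.

(** Fix the columns of an interlacing matrix other than i and i+1, and the
    sums [pairsum]. Its entries in column i then vary independently: the one
    of row r lies between [lower] and [upper]. The lower bound of row r and
    the upper bound of row r+1 come from the same two rows, and add up to
    the sum [pairsum] of row r+1. *)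
Definition upper m r :=
  if r is r'.+1 then
    if I r' then minn (pairsum m r) (psum m r' i - psum m r i)
    else pairsum m r
  else pairsum m r.

(** In row r0 the upper bound is replaced, so that delta units remain in
    column i+1. *)
Definition cap m r := if r == r0 then pairsum m r - delta else upper m r.

Definition lower m r := pairsum m r.+1 - cap m r.+1.

Definition toggled m r :=
  if r < r0 then m r i else lower m r + cap m r - m r i.

Definition toggle m r j :=
  if j == i then toggled m r
  else if j == i.+1 then pairsum m r - toggled m r
  else m r j.

Lemma upper_le m r : upper m r <= pairsum m r.
Proof. by case: r => //= r; case: ifP => // _; apply: geq_minl. Qed.

Lemma cap_le m r : cap m r <= pairsum m r.
Proof. by rewrite /cap; case: eqP => _; [apply: leq_subr|apply: upper_le]. Qed.

Section Valid.

Variable m : nat -> nat -> nat.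
Hypothesis Rm : forall r, I r -> interlaced m r.
Hypothesis delta_le : delta <= m r0 i.+1.
Hypothesis cap_upper : pairsum m r0 - delta <= upper m r0.

Lemma le_upper r : m r i <= upper m r.
Proof.
rewrite /upper /pairsum; case: r => [|r]; first exact: leq_addr.
case: ifP => [Ir|_]; last exact: leq_addr.
by have := Rm Ir i; rewrite psumS; lia.
Qed.

Lemma cap_le_upper r : cap m r <= upper m r.
Proof. by rewrite /cap; case: eqP => // ->. Qed.

Lemma le_cap r : m r i <= cap m r.
Proof.
rewrite /cap; case: eqP => [->|_]; last exact: le_upper.
by rewrite /pairsum; lia.
Qed.

Lemma lower_le r : r0 <= r -> lower m r <= m r i.
Proof.
move=> r0r; rewrite /lower /cap gtn_eqF ?ltnS // /upper.
case: ifP => [Ir|_]; last by rewrite subnn.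
by have := Rm Ir i.+1; rewrite !psumS /pairsum; lia.
Qed.

Lemma toggled_cap r : toggled m r <= cap m r.
Proof.
rewrite /toggled; case: ltnP => [_|r0r]; first exact: le_cap.
by have := lower_le r0r; lia.
Qed.

Lemma toggled_le r : toggled m r <= pairsum m r.
Proof. exact: leq_trans (toggled_cap r) (cap_le m r). Qed.

Lemma toggle_pairsum r : pairsum (toggle m) r = pairsum m r.
Proof.
rewrite /pairsum /toggle eqxx gtn_eqF // eqxx subnKC //.
exact: toggled_le.
Qed.

Lemma psum_toggle_le r j : j <= i -> psum (toggle m) r j = psum m r j.
Proof.
move=> ji; apply: eq_psum => l lj; rewrite /toggle.
by rewrite !ltn_eqF //; lia.
Qed.

Lemma psum_toggle_gt r j : i.+1 < j -> psum (toggle m) r j = psum m r j.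
Proof.
elim: j => // j IH; rewrite ltnS leq_eqVlt => /predU1P[<-|ij].
  have := toggle_pairsum r; rewrite /pairsum => e.
  by rewrite !psumS -!addnA e psum_toggle_le.
by rewrite !psumS IH // /toggle !gtn_eqF //; lia.
Qed.

Lemma psum_toggle_mid r : psum (toggle m) r i.+1 = psum m r i + toggled m r.
Proof. by rewrite psumS psum_toggle_le // /toggle eqxx. Qed.

Lemma toggle_interlaced r : I r -> interlaced (toggle m) r.
Proof.
move=> Ir j; have [ji|ij] := leqP j.+1 i.
  by rewrite !psum_toggle_le //; [apply: Rm|lia].
move: ij; rewrite leq_eqVlt => /predU1P[[<-]|].
  rewrite psum_toggle_mid psum_toggle_le //.
  have := leq_trans (toggled_cap r.+1) (cap_le_upper r.+1).
  by rewrite /upper Ir; have := Rm Ir i; rewrite psumS; lia.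
rewrite ltnS leq_eqVlt => /predU1P[<-|ij]; last first.
  by rewrite !psum_toggle_gt //; [apply: Rm|lia].
rewrite psum_toggle_gt // psum_toggle_mid !psumS.
have := Rm Ir i.+1; have := Rm Ir i; rewrite !psumS => R0 R1.
rewrite /toggled; case: ltnP => [_|r0r]; first lia.
have := le_cap r; rewrite /lower {2}/cap gtn_eqF ?ltnS // /upper Ir /pairsum.
lia.
Qed.

Lemma toggle_mask (Z : nat -> nat -> bool) :
    (forall r, Z r i = Z r i.+1) -> (forall r j, m r j != 0 -> Z r j) ->
  forall r j, toggle m r j != 0 -> Z r j.
Proof.
move=> Zi Zm r j; have [Zri|/negbTE Zri] := boolP (Z r i).
  rewrite /toggle; have [-> //|_] := eqVneq j i.
  by have [->|_] := eqVneq j i.+1; [rewrite -Zi|apply: Zm].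
have n0 : pairsum m r = 0.
  rewrite /pairsum; have := Zm r i; have := Zm r i.+1; rewrite -Zi Zri; lia.
have := toggled_le r; rewrite /toggle n0 leqn0 => /eqP ->.
rewrite subnn; have [//|_] := eqVneq j i.
by have [//|_] := eqVneq j i.+1; apply: Zm.
Qed.

Lemma toggleK : toggle (toggle m) = m.
Proof.
apply/funext => r; apply/funext => j.
have upE s : upper (toggle m) s = upper m s.
  case: s => [|s] /=; first exact: toggle_pairsum.
  by rewrite toggle_pairsum !psum_toggle_le.
have capE s : cap (toggle m) s = cap m s by rewrite /cap toggle_pairsum upE.
have togE : toggled (toggle m) r = m r i.
  have ti s : toggle m s i = toggled m s by rewrite /toggle eqxx.
  rewrite {1}/toggled ti /toggled; case: ltnP => // r0r.
  rewrite /lower !capE toggle_pairsum -/(lower m r).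
  by have := le_cap r; have := lower_le r0r; lia.
rewrite {1}/toggle togE toggle_pairsum /pairsum.
have [-> //|ji] := eqVneq j i; have [->|ji'] := eqVneq j i.+1.
  by rewrite addKn.
by rewrite /toggle (negbTE ji) (negbTE ji').
Qed.

(** As [lower m r + cap m r.+1 = pairsum m r.+1], the sums of the two bounds
    telescope over the rows; only the bound imposed on row r0 is left. *)
Lemma toggle_sum p : (forall r j, p <= r -> m r j = 0) -> r0 <= p ->
  \sum_(r0 <= r < p) toggle m r i + delta = \sum_(r0 <= r < p) m r i.+1.
Proof.
move=> m0 r0p.
have tel K : r0 <= K ->
    \sum_(r0 <= r < K) (toggle m r i + m r i) + cap m K + delta =
    \sum_(r0 <= r < K.+1) pairsum m r.
  elim: K => [|K IH].
    rewrite leqn0 => /eqP r00; rewrite r00 big_geq // big_nat1 /cap r00 eqxx.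
    by move: delta_le; rewrite /pairsum r00; lia.
  rewrite leq_eqVlt => /predU1P[e|]; last first.
    rewrite ltnS => r0K; rewrite big_nat_recr //= [RHS]big_nat_recr ?leqW //=.
    rewrite -IH //.
    have -> : toggle m K i = lower m K + cap m K - m K i.
      by rewrite /toggle eqxx /toggled ltnNge r0K.
    have := cap_le m K.+1; have := le_cap K; have := lower_le r0K.
    rewrite /lower; lia.
  rewrite -e big_geq // big_nat1 /cap eqxx.
  by move: delta_le; rewrite /pairsum; lia.
have := tel p r0p; rewrite big_nat_recr //= big_split /=.
have -> : pairsum m p = 0 by rewrite /pairsum !m0.
have -> : cap m p = 0.
  by apply/eqP; rewrite -leqn0 (leq_trans (cap_le _ _)) // /pairsum !m0.
rewrite big_split /=; lia.
Qed.

End Valid.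

End Toggle.

(** The lattice condition fails at row r for the letters i+1 and i+2:
    reading the rows from the top, and each of them from its right end,
    there are too many i+2 once those of row r have been read. *)
Definition violates m r i := psum (tr m) i r < psum (tr m) i.+1 r.+1.

(** In the first bad row the last bad column is chosen: changing the entries
    of columns i and i+1 in that row affects the violations for i-1 and i
    only. *)
Definition first_violation (J : nat -> bool) m r i :=
  [/\ J i, violates m r i,
      forall r' j, r' < r -> J j -> ~~ violates m r' j
    & forall j, i < j -> J j -> ~~ violates m r j].

(** The part of the entry in row r and column i+1 that has to be kept for
    the violation to persist. *)
Definition deficit m r i := (psum (tr m) i r).+1 - psum (tr m) i.+1 r.

Lemma leq_psum m r : {homo psum m r : j l / j <= l}.
Proof.
move=> j l; elim: l => [|l IH]; first by rewrite leqn0 => /eqP ->.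
rewrite leq_eqVlt => /predU1P[-> //|]; rewrite ltnS => /IH.
by rewrite psumS; lia.
Qed.

Lemma psum_tr m i r : psum (tr m) i r = \sum_(0 <= q < r) m q i.
Proof. by rewrite big_mkord. Qed.

Lemma psum_tr_cat m i r0 p : r0 <= p ->
  psum (tr m) i p = psum (tr m) i r0 + \sum_(r0 <= q < p) m q i.
Proof. by move=> rp; rewrite !psum_tr (big_cat_nat (n := r0)). Qed.

Section Exchange.

Variables (I J : nat -> bool) (m : nat -> nat -> nat) (p : nat).
Hypothesis Rm : forall r, I r -> interlaced m r.
Hypothesis mp : forall r j, p <= r -> m r j = 0.

(** The rows above r0 keep their entries, and the others exchange their sums
    in columns i and i+1, up to delta. *)
Lemma toggle_psum_tr r0 i d : d <= m r0 i.+1 ->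
    pairsum i m r0 - d <= upper I i m r0 -> r0 <= p ->
    let m' := toggle I i r0 d m in
  psum (tr m') i p + psum (tr m) i.+1 r0 + d =
    psum (tr m) i.+1 p + psum (tr m) i r0
  /\ psum (tr m') i.+1 p + psum (tr m) i r0 =
    psum (tr m) i p + psum (tr m) i.+1 r0 + d.
Proof.
move=> dm cu r0p m'.
have tm := toggle_sum Rm dm cu mp r0p.
have tot s : psum (tr m') i s + psum (tr m') i.+1 s =
    psum (tr m) i s + psum (tr m) i.+1 s.
  rewrite /psum -!big_split; apply: eq_bigr => q _.
  exact: (toggle_pairsum Rm dm cu q).
have e : psum (tr m') i r0 = psum (tr m) i r0.
  by apply: eq_psum => q qr; rewrite /tr /m' /toggle eqxx /toggled qr.
move: (tot p).
rewrite (psum_tr_cat m' i r0p) (psum_tr_cat m i.+1 r0p) e; move: tm;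
  rewrite -/m'; lia.
Qed.

(** Without a bound in row 0, the toggle exchanges the two column sums. *)
Lemma swap_colsum i : let m' := toggle I i 0 0 m in
  psum (tr m') i p = psum (tr m) i.+1 p /\
  psum (tr m') i.+1 p = psum (tr m) i p.
Proof.
move=> m'; have cu : pairsum i m 0 - 0 <= upper I i m 0 by rewrite subn0.
by have [] := toggle_psum_tr (leq0n _) cu (leq0n _); rewrite -/m' !psum0; lia.
Qed.

Section First.

Variables r i : nat.
Hypothesis fv : first_violation J m r i.

Let d := deficit m r i.

(** There is no violation in the previous row. *)
Lemma first_violation_le : psum (tr m) i.+1 r <= psum (tr m) i r.-1.
Proof.
case: fv => Ji _ + _; case: (r) => [|s] /=; first by rewrite !psum0.
by move/(_ s i (ltnSn s) Ji); rewrite -leqNgt.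
Qed.

Lemma deficit_le : d <= m r i.+1.
Proof.
case: fv => _ + _ _; rewrite /violates psumS /d /deficit /tr; lia.
Qed.

(** By [first_violation_le], the deficit exceeds the entry of row r-1 in
    column i. The interlacing of the rows r-1 and r then leaves room for all
    the other letters of the two columns in column i of row r. *)
Lemma deficit_cap : pairsum i m r - d <= upper I i m r.
Proof.
have := first_violation_le; rewrite /d /deficit /upper.
case: (r) => [|s] /=; first by lia.
case: ifP => Is; last by lia.
have := Rm Is i.+1; rewrite !psumS /pairsum -[tr m i s]/(m s i); lia.
Qed.

Let m' := toggle I i r d m.

Lemma violation_ltn : r < p.
Proof.
have := deficit_le; have := first_violation_le; rewrite /d /deficit.
have := leq_psum (tr m) i (leq_pred r).
by case: ltnP => // pr; rewrite (mp _ pr); lia.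
Qed.

(** The column sums, made strict by subtracting i from the i-th one, are
    exchanged. This is why the toggle below the first violation matches a
    transposition in the alternating sum [alternant]. *)
Lemma exchange_colsum :
  psum (tr m') i p + 1 = psum (tr m) i.+1 p /\
  psum (tr m') i.+1 p = psum (tr m) i p + 1.
Proof.
have [] := toggle_psum_tr deficit_le deficit_cap (ltnW violation_ltn).
have := first_violation_le; have := leq_psum (tr m) i (leq_pred r).
rewrite -/m' /d /deficit; lia.
Qed.

Lemma exchange_psum_tr j s : s <= r -> psum (tr m') j s = psum (tr m) j s.
Proof.
move=> sr; apply: eq_psum => q qs; rewrite /tr /m' /toggle /toggled.
rewrite (leq_trans qs sr); have [-> //|_] := eqVneq j i.
by have [->|] := eqVneq j i.+1; rewrite // /pairsum addKn.
Qed.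

Lemma exchange_deficit : deficit m' r i = d.
Proof. by rewrite /d /deficit !exchange_psum_tr. Qed.

Lemma exchange_first_violation : first_violation J m' r i.
Proof.
case: fv => Ji bad prev next; split=> //.
- rewrite /violates psumS !exchange_psum_tr //.
  have -> : tr m' i.+1 r = pairsum i m r - toggled I i r d m r.
    by rewrite /tr /m' /toggle gtn_eqF // eqxx.
  have := toggled_cap Rm deficit_le deficit_cap r.
  rewrite /cap eqxx; have := deficit_le.
  have := first_violation_le; have := leq_psum (tr m) i (leq_pred r).
  rewrite /d /deficit /pairsum; lia.
- move=> r' j r'r Jj; rewrite /violates !exchange_psum_tr ?(ltnW r'r) //.
  exact: prev.
- move=> j ij Jj; have := next j ij Jj.
  rewrite /violates !psumS !exchange_psum_tr //.
  have -> // : tr m' j.+1 r = tr m j.+1 r.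
  by rewrite /tr /m' /toggle !gtn_eqF //; lia.
Qed.

(** The deficit depends on the rows above r only, so that the same toggle is
    applied twice. *)
Lemma exchangeK : toggle I i r (deficit m' r i) m' = m.
Proof. rewrite exchange_deficit;
  exact: (toggleK Rm deficit_le deficit_cap). Qed.

End First.

End Exchange.

Lemma first_violation_uniq J m r i r' i' :
  first_violation J m r i -> first_violation J m r' i' -> r = r' /\ i = i'.
Proof.
move=> [Ji b1 p1 n1] [Ji' b2 p2 n2].
have er : r = r'.
  case: (ltngtP r r') => // rr.
    by have := p2 _ _ rr Ji; rewrite b1.
  by have := p1 _ _ rr Ji'; rewrite b2.
split=> //; subst r'; case: (ltngtP i i') => // ii.
  by have := n1 _ ii Ji'; rewrite b2.
by have := n2 _ ii Ji; rewrite b1.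
Qed.

Lemma first_violation_exists (J : nat -> bool) m q :
    (forall i, J i -> i < q) ->
    (exists i, J i /\ ~ interlaced (tr m) i) ->
  exists r i, first_violation J m r i.
Proof.
move=> Jq [i0 [Ji0 /existsNP[r1 /negP]]]; rewrite -ltnNge => bad0.
(* The first bad row, then the last bad column in it. *)
pose P r := [exists i : 'I_q, J i && violates m r i].
have exP : exists r, P r.
  by exists r1; apply/existsP; exists (Ordinal (Jq _ Ji0)); rewrite /= Ji0.
case: (ex_minnP exP) => r /existsP[i /andP[Ji bi]] minr.
pose Q i := J i && violates m r i.
have exQ : exists i, Q i by exists i; rewrite /Q Ji.
have Qq j : Q j -> j <= q by move=> /andP[/Jq /ltnW].
case: (ex_maxnP exQ Qq) => j /andP[Jj bj] maxj.
exists r, j; split=> // [r' l r'r Jl|l jl Jl]; apply/negP => bl.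
  have : P r' by apply/existsP; exists (Ordinal (Jq _ Jl)); rewrite /= Jl.
  by move/minr; rewrite leqNgt r'r.
by have := maxj l; rewrite /Q Jl bl leqNgt jl => /(_ isT).
Qed.

(** * Symmetric functions determined by alternating sums *)

Local Open Scope ring_scope.

Section Weights.

Variables (q : nat) (b : nat -> nat).
Hypothesis b_mono : {homo b : i j / (i <= j)%N}.

Implicit Types (la al : 'I_q -> int) (w : 'S_q) (i j : 'I_q).

(** The blocks are the fibres of b. *)
Definition dominant la : Prop :=
  forall i j, j = i.+1 :> nat -> b i = b j -> la j <= la i.

Definition preserves w : bool := [forall i, b (w i) == b i].

(** The dot action of w, for the staircase -i. *)
Definition shifted la w : 'I_q -> int :=
  fun i => la (w i) - (w i : nat)%:Z + (i : nat)%:Z.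

(** If f gives the coefficients of a symmetric polynomial, this is the
    coefficient of the monomial la + rho in its product with the Vandermonde
    alternants of the blocks. *)
Definition alternant (f : ('I_q -> int) -> int) la : int :=
  \sum_(w | preserves w) (-1) ^+ (odd_perm w) * f (shifted la w).

Lemma preserves1 : preserves 1%g.
Proof. by apply/forallP => i; rewrite perm1. Qed.

Lemma shifted1 la : shifted la 1%g = la.
Proof. by apply/funext => i; rewrite /shifted perm1 subrK. Qed.

Lemma dominant_lt la i j : dominant la -> (i < j)%N -> b i = b j ->
  la j - (j : nat)%:Z < la i - (i : nat)%:Z.
Proof.
move=> dl; case: j => j jq /=; elim: j jq => // j IH jq.
rewrite ltnS => ij e; have jq' : (j < q)%N by apply: ltnW.
have bj : b i = b j.
  apply/eqP; rewrite eqn_leq b_mono //= e; exact: b_mono.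
have step : la (Ordinal jq) <= la (Ordinal jq').
  by apply: dl => //=; rewrite -bj e.
move: ij; rewrite leq_eqVlt => /predU1P[eij|ij].
  have -> : i = Ordinal jq' by apply: val_inj.
  by rewrite /=; move: step; lia.
by have := IH jq' ij bj; move: step; rewrite /=; lia.
Qed.

Lemma perm_homo_id w : (forall i j, (i < j)%N -> (w i < w j)%N) -> w = 1%g.
Proof.
move=> wh; suff le (s : {perm 'I_q}) i : (forall i j, (i < j)%N ->
  (s i < s j)%N) ->
    (i <= s i)%N.
  have wh' i j : (i < j)%N -> ((w^-1)%g i < (w^-1)%g j)%N.
    move=> ij; case: (ltngtP ((w^-1)%g i) ((w^-1)%g j)) =>
      // [/wh|/val_inj/perm_inj e].
      by rewrite !permKV ltnNge (ltnW ij).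
    by rewrite e ltnn in ij.
  apply/permP => i; rewrite perm1; apply/val_inj/eqP; rewrite eqn_leq le //.
  by have := le (w^-1)%g (w i) wh'; rewrite permK => ->.
move=> sh; case: i => i; elim: i => // i IH iq.
have iq' : (i < q)%N by apply: ltnW.
by have := sh (Ordinal iq') (Ordinal iq) (ltnSn _); apply: leq_ltn_trans;
  apply: IH.
Qed.

(** Both sequences la i - i and la (w i) - w i strictly decrease along each
    block, so that w is increasing. *)
Lemma dominant_shifted la w :
  dominant la -> preserves w -> dominant (shifted la w) -> w = 1%g.
Proof.
move=> dl /forallP pw ddl; apply: perm_homo_id => i j ij.
have bw x : b (w x) = b x by apply/eqP/pw.
case: (ltngtP (w i) (w j)) => // [ji|/val_inj/perm_inj e]; last first.
  by rewrite e ltnn in ij.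
have bij : b i = b j.
  by apply/eqP; rewrite eqn_leq b_mono ?(ltnW ij) //= -(bw i) -(bw j) b_mono //
    ltnW.
have := dominant_lt ddl ij bij.
have := dominant_lt dl ji; rewrite !bw bij => /(_ erefl); rewrite /shifted.
lia.
Qed.

(** The squared norm of al - i: it is invariant under the dot action, and
    increases when an ascent of al is exchanged. *)
Definition energy al : int := \sum_i (al i - (i : nat)%:Z) ^+ 2.

Lemma energy_shifted la w : energy (shifted la w) = energy la.
Proof.
rewrite /energy [RHS](reindex_perm w) /=.
by apply: eq_bigr => i _; rewrite /shifted addrK.
Qed.

Lemma energy_tperm al i j : j = i.+1 :> nat -> al i < al j ->
  energy al < energy (al \o tperm i j).
Proof.
move=> eij lt; have ij : i != j by apply/eqP => e; rewrite -e in eij; lia.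
rewrite /energy (bigD1 i) // [ltRHS](bigD1 i) //=.
rewrite (bigD1 j) 1?eq_sym // [X in _ < _ + X](bigD1 j) 1?eq_sym //=.
rewrite tpermL tpermR !addrA [X in _ + X < _](eq_bigr (fun l : 'I_q =>
  (al (tperm i j l) - (l : nat)%:Z) ^+ 2)); last first.
  by move=> l /andP[li lj]; rewrite tpermD // eq_sym.
rewrite ltrD2r eij -subr_gt0.
rewrite (_ : _ - _ = (al j - al i) *+ 2) ?pmulrn_lgt0 ?subr_gt0 //.
by rewrite intS; ring.
Qed.

(** Among the points where f does not vanish, take al of maximal energy. It
    is dominant, since otherwise exchanging an ascent would increase the
    energy. Its other images under the dot action have the same energy
    without being dominant, so f vanishes there, and the alternating sum at
    al is f al. *)
Lemma alternant_vanish (f : ('I_q -> int) -> int) (B : int) :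
    (forall al i j, j = i.+1 :> nat -> b i = b j ->
      f (al \o tperm i j) = f al) ->
    (forall al, f al != 0 -> energy al <= B) ->
    (forall la, dominant la -> alternant f la = 0) ->
  forall al, f al = 0.
Proof.
move=> fsym fB falt.
(* Induction on the distance from the energy of al to the bound B. *)
suff H n al : B < energy al + n%:Z -> f al = 0.
  move=> al; apply: (H (absz (B - energy al + 1))); lia.
elim: n al => [|n IH] al lt.
  by apply/eqP; apply: contraTT lt => /fB; lia.
(* At a given energy level, non-dominant weights can be moved up by a
   transposition. *)
have nd al' : energy al' = energy al -> ~ dominant al' -> f al' = 0.
  move=> e /existsNP[i /existsNP[j]]; rewrite not_implyE => -[ij].
  rewrite not_implyE => -[bij /negP]; rewrite -ltNge => lij.
  rewrite -(fsym _ _ _ ij bij); apply: IH.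
  by have := energy_tperm ij lij; rewrite e; lia.
have [dal|] := pselect (dominant al); last exact: nd.
have := falt al dal; rewrite /alternant (bigD1 1%g) ?preserves1 //=.
rewrite shifted1 odd_perm1 expr0 mul1r big1 ?addr0 // => w /andP[pw w1].
rewrite nd ?mulr0 ?energy_shifted // => dw.
by rewrite (dominant_shifted dal pw dw) eqxx in w1.
Qed.

End Weights.

(** * Counting bounded matrices *)

Local Open Scope nat_scope.

Section Matrices.

Variable d : nat.

(** The bound on the entries only serves to have a finite type: conditions
    are stated on functions of two natural numbers, and all matrices that
    are counted have total sum d ([fits]). *)
Definition mx p q := {ffun 'I_p * 'I_q -> 'I_d.+1}.

Definition ent p q (M : mx p q) r j : nat :=
  if insub r is Some r' then if insub j is Some j' then M (r', j') : nat else 0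
  else 0.

Definition mk p q (m : nat -> nat -> nat) : mx p q :=
  [ffun x : 'I_p * 'I_q => inord (m x.1 x.2)].

Definition fits p q (m : nat -> nat -> nat) : Prop :=
  (forall r j, m r j != 0 -> (r < p) && (j < q)) /\ \sum_(r < p) psum m r q = d.

Lemma fits_le p q m r j : fits p q m -> m r j <= d.
Proof.
move=> [supp <-]; have [->//|] := eqVneq (m r j) 0.
move=> /supp/andP[rp jq].
rewrite (bigD1 (Ordinal rp)) //= /psum (bigD1 (Ordinal jq)) //=; lia.
Qed.

Lemma entE p q (M : mx p q) (r : 'I_p) (j : 'I_q) : ent M r j = M (r, j).
Proof. by rewrite /ent !valK. Qed.

Lemma ent_supp p q (M : mx p q) r j : ent M r j != 0 -> (r < p) && (j < q).
Proof. by rewrite /ent; case: insubP => // r' -> _;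
  case: insubP => // j' ->. Qed.

Lemma mkK p q m : fits p q m -> ent (mk p q m) = m.
Proof.
move=> fm; apply/funext => r; apply/funext => j.
have [/andP[rp jq]|out] := boolP ((r < p) && (j < q)).
  rewrite (entE _ (Ordinal rp) (Ordinal jq)) ffunE /= inordK //.
  exact: fits_le fm.
have [-> |/(ent_supp)] := eqVneq (ent (mk p q m) r j) 0;
  last by rewrite (negbTE out).
by have [//|/(proj1 fm)] := eqVneq (m r j) 0; rewrite (negbTE out).
Qed.

Lemma entK p q (M : mx p q) : mk p q (ent M) = M.
Proof.
by apply/ffunP => -[r j]; rewrite ffunE entE; apply/val_inj; rewrite /= inordK.
Qed.

Lemma ent_inj p q : injective (@ent p q).
Proof. by move=> M N e; rewrite -(entK M) e entK. Qed.

Definition num_mx p q (P : (nat -> nat -> nat) -> Prop) : nat :=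
  #|[pred M : mx p q | `[< P (ent M) >]]|.

Lemma leq_num_mx p q p' q' (P P' : (nat -> nat -> nat) -> Prop) f :
    (forall m, P m -> fits p q m) ->
    (forall m, P m -> P' (f m)) -> (forall m, P' m -> fits p' q' m) ->
    (forall m n, P m -> P n -> f m = f n -> m = n) ->
  num_mx p q P <= num_mx p' q' P'.
Proof.
move=> Pf fP P'f finj; pose g (M : mx p q) : mx p' q' := mk p' q' (f (ent M)).
have gK M : P (ent M) -> ent (g M) = f (ent M).
  by move=> PM; rewrite mkK //; apply/P'f/fP.
have ginj : {in [pred M | `[< P (ent M) >]] &, injective g}.
  move=> M N /asboolP PM /asboolP PN e; apply/ent_inj/finj => //.
  by rewrite -!gK ?e.
rewrite /num_mx -(card_in_image ginj); apply: subset_leq_card.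
apply/fintype.subsetP => N /fintype.imageP[M /asboolP PM ->].
by apply/asboolP; rewrite gK //; apply: fP.
Qed.

Lemma num_mx_bij p q p' q' (P P' : (nat -> nat -> nat) -> Prop) f g :
    (forall m, P m -> fits p q m) -> (forall m, P' m -> fits p' q' m) ->
    (forall m, P m -> P' (f m) /\ g (f m) = m) ->
    (forall m, P' m -> P (g m) /\ f (g m) = m) ->
  num_mx p q P = num_mx p' q' P'.
Proof.
move=> Pf P'f fP gP; apply/eqP; rewrite eqn_leq; apply/andP; split.
  apply: (@leq_num_mx _ _ _ _ P P' f) =>
    // [m /fP[]//|m n /fP[_ {2}<-] /fP[_ {2}<-]].
  by move=> ->.
apply: (@leq_num_mx _ _ _ _ P' P g) =>
  // [m /gP[]//|m n /gP[_ {2}<-] /gP[_ {2}<-]].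
by move=> ->.
Qed.

(** Z is the set of positions where entries may be nonzero; consecutive rows
    interlace when bI puts them in the same block, and so do consecutive
    columns for bJ. With [id] as block function there is no condition. *)
Definition constrained (Z : nat -> nat -> bool) (bI bJ : nat -> nat) m : Prop :=
  [/\ forall r j, m r j != 0 -> Z r j,
      forall r, bI r = bI r.+1 -> interlaced m r
    & forall j, bJ j = bJ j.+1 -> interlaced (tr m) j].

Definition rowsums p q m (be : 'I_p -> int) : Prop :=
  forall r : 'I_p, Posz (psum m r q) = be r.

Definition admissible p q Z bI bJ (be : 'I_p -> int) (al : 'I_q ->
  int) m : Prop :=
  [/\ fits p q m, constrained Z bI bJ m, rowsums q m be & rowsums p (tr m) al].

(** Sums are prescribed as integers, because the shifted weights of an
    alternating sum may be negative. *)
Definition num_adm p q Z bI bJ (be : 'I_p -> int) (al : 'I_q -> int) : nat :=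
  num_mx p q (admissible Z bI bJ be al).

Lemma fits_tr p q m : fits p q m -> fits q p (tr m).
Proof.
move=> [s t]; split=> [r j /s|]; first by rewrite andbC.
by rewrite -t /psum exchange_big.
Qed.

Lemma fits_colsum_le p q m (j : 'I_q) : fits p q m -> psum (tr m) j p <= d.
Proof.
by move=> /fits_tr[_ t]; rewrite -[X in _ <= X]t (bigD1 j) //= leq_addr.
Qed.

(** Transposition turns tableaux of shape be and content al into lattice
    matrices with row sums al and column sums be. *)
Lemma num_adm_tr p q Z bI bJ (be : 'I_p -> int) (al : 'I_q -> int) :
  num_adm Z bI bJ be al = num_adm (fun r j => Z j r) bJ bI al be.
Proof.
apply: (@num_mx_bij _ _ _ _ _ _ tr tr) => [m []//|m []//|m|m];
  by move=> [f [z R C] rs cs]; split=> //; split=> //;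
    [apply: fits_tr|split=> // r j /z].
Qed.

End Matrices.

(** * Symmetry in the column sums *)

Local Open Scope ring_scope.

Definition link (b : nat -> nat) r : bool := b r == b r.+1.

Lemma sum_involution (T : finType) (P : pred T) (h : T -> T) (F : T -> int) :
    (forall x, P x -> [/\ P (h x), h (h x) = x & F (h x) = - F x]) ->
  \sum_(x | P x) F x = 0.
Proof.
move=> hP; suff e : \sum_(x | P x) F x = - \sum_(x | P x) F x by lia.
rewrite {1}(reindex_onto h h) => [|x /hP[]//].
rewrite -sumrN; apply: eq_big => x; last first.
  by case/andP=> /hP[_ _ e] /eqP hx; rewrite -{2}hx e opprK.
apply/andP/idP => [[/hP[Phh _ _] /eqP hx]|/hP[-> -> _]] //.
by rewrite -hx.
Qed.

Section Counting.

Variables (d p q : nat) (Z : nat -> nat -> bool) (bI bJ : nat -> nat).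
Variable be : 'I_p -> int.

Lemma constrained_lattice m : constrained Z bI bJ m <->
  constrained Z bI id m /\ forall j, bJ j = bJ j.+1 -> interlaced (tr m) j.
Proof.
split=> [[z R C]|[[z R _] C]]; split=> //.
by split=> // j /n_Sn.
Qed.

Lemma admissible_lattice (al : 'I_q -> int) m : admissible d Z bI bJ be al m <->
  admissible d Z bI id be al m /\ forall j, bJ j = bJ j.+1 ->
    interlaced (tr m) j.
Proof.
split=> [[f /constrained_lattice[w C] rs cs]|[[f w rs cs] C]]; split=> //.
by apply/constrained_lattice.
Qed.

Lemma admissible_toggle (al al' : 'I_q -> int) m (i j : 'I_q) r0 delta :
    j = i.+1 :> nat -> (forall r, Z r i = Z r i.+1) ->
    admissible d Z bI id be al m -> (delta <= m r0 i.+1)%N ->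
    (pairsum i m r0 - delta <= upper (link bI) i m r0)%N ->
    let m' := toggle (link bI) i r0 delta m in
    (forall l, l != i -> l != j -> al' l = al l) ->
    Posz (psum (tr m') i p) = al' i -> Posz (psum (tr m') i.+1 p) = al' j ->
  admissible d Z bI id be al' m'.
Proof.
move=> ij Zi [[supp tot] [z R _] rs cs] dm cu m' al'l al'i al'j.
have Rm r : link bI r -> interlaced m r by move=> /eqP/R.
have rsE r : psum m' r q = psum m r q.
  by rewrite (psum_toggle_gt Rm dm cu) // -ij.
split.
- split; last by rewrite -tot; apply: eq_bigr => r _.
  apply: (toggle_mask Rm dm cu) => // r.
  by rewrite ltn_ord -ij ltn_ord.
- split; first exact: (toggle_mask Rm dm cu); last by move=> l /n_Sn.
  by move=> r e; apply: (toggle_interlaced Rm dm cu); apply/eqP.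
- by move=> r; rewrite rsE.
- move=> l; have [->//|li] := eqVneq l i.
  have [->|lj] := eqVneq l j; first by rewrite ij.
  rewrite al'l // -cs; congr Posz; apply: eq_psum => r _.
  rewrite /tr /m' /toggle; have -> : ((l : nat) == i) = false by exact: negbTE.
  by rewrite -ij; have -> : ((l : nat) == j) = false by exact: negbTE.
Qed.

(** Toggling columns i and i+1 in all rows is an involution that exchanges
    the two column sums. *)
Lemma num_adm_tperm (al : 'I_q -> int) (i j : 'I_q) :
    j = i.+1 :> nat -> (forall r, Z r i = Z r i.+1) ->
  num_adm d Z bI id be (al \o tperm i j) = num_adm d Z bI id be al.
Proof.
move=> ij Zi; pose t := toggle (link bI) i 0%N 0%N.
have cu m : (pairsum i m 0%N - 0 <= upper (link bI) i m 0%N)%N by rewrite subn0.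
have Rm (al' : 'I_q -> int) m : admissible d Z bI id be al' m ->
  forall r, link bI r -> interlaced m r.
  by move=> [_ [_ R _] _ _] r /eqP/R.
have key al' m : admissible d Z bI id be al' m ->
    admissible d Z bI id be (al' \o tperm i j) (t m) /\ t (t m) = m.
  move=> a; split; last exact: (toggleK (Rm _ _ a) (leq0n _) (cu m)).
  have mp r l : (p <= r)%N -> m r l = 0%N.
    move=> pr; case: a => -[s _] _ _ _; apply/eqP/negPn; apply/negP => /s.
    by rewrite ltnNge pr.
  have [si sj] := swap_colsum (Rm _ _ a) mp i.
  case: (a) => _ _ _ cs.
  apply: (admissible_toggle (j := j) ij Zi a) => //.
  - by move=> l li lj; rewrite /= tpermD // eq_sym.
  - by rewrite si -ij cs /= tpermL.
  - by rewrite sj cs /= tpermR.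
apply: (@num_mx_bij _ _ _ _ _ _ _ t t) => [m []//|m []//|m /key|m /key] [] //.
suff -> : (al \o tperm i j) \o tperm i j = al by [].
by apply/funext => l; rewrite /= tpermK.
Qed.

End Counting.

(** * Lattice matrices as alternating sums *)

Section SignReversing.

Variables (d p q : nat) (Z : nat -> nat -> bool) (bI bJ : nat -> nat).
Variable be : 'I_p -> int.
Hypothesis bJ_mono : {homo bJ : i j / (i <= j)%N}.
Hypothesis ZJ : forall r j, (j.+1 < q)%N -> bJ j = bJ j.+1 -> Z r j = Z r j.+1.

Definition lattice_mx (b : nat -> nat) m : Prop :=
  forall j, b j = b j.+1 -> interlaced (tr m) j.

Definition adj_tperm (i : nat) : 'S_q :=
  if insub i is Some i' then
    if insub i.+1 is Some j' then tperm i' j' else 1%g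
  else 1%g.

Lemma adj_tpermE (i j : 'I_q) : j = i.+1 :> nat -> adj_tperm i = tperm i j.
Proof. by move=> ij; rewrite /adj_tperm valK -ij valK. Qed.

Definition link_below (j : nat) : bool := link bJ j && (j.+1 < q)%N.

Definition violation m : nat * nat :=
  xget (0, 0)%N [set x | first_violation link_below m x.1 x.2].

(** The toggle at the first violation, coupled with the corresponding
    transposition. *)
Definition sign_flip (x : 'S_q * mx d p q) : 'S_q * mx d p q :=
  let m := ent x.2 in let: (r, i) := violation m in
  ((adj_tperm i * x.1)%g, mk d p q (toggle (link bI) i r (deficit m r i) m)).

Lemma violationE m r i : first_violation link_below m r i ->
  violation m = (r, i).
Proof.
move=> fv; rewrite /violation; case: xgetP => [[r' i'] _ /= fv'|/(_ (r, i))//].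
by have [-> ->] := first_violation_uniq fv' fv.
Qed.

(** Columns beyond q are empty, so that they never give a violation. *)
Lemma not_latticeP m : (forall r j, (q <= j)%N -> m r j = 0%N) ->
  ~ lattice_mx bJ m <-> exists r i, first_violation link_below m r i.
Proof.
move=> mq; split=> [nl|[r [i [/andP[/eqP bi _] v _ _ lat]]]]; last first.
  by have := lat i bi r; rewrite leqNgt -/(violates m r i) v.
apply: (@first_violation_exists link_below m q) => [i /andP[_ /ltnW]//|].
move: nl => /existsNP[j]; rewrite not_implyE => -[bj nR].
exists j; split=> //; rewrite /link_below /link bj eqxx /= ltnNge;
  apply/negP => qj.
by apply: nR => r; rewrite /psum big1 // => s _; apply: mq.
Qed.

Lemma sign_flipP (la : 'I_q -> int) x :
    preserves bJ x.1 -> admissible d Z bI id be (shifted la x.1) (ent x.2) ->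
    ~ lattice_mx bJ (ent x.2) ->
  [/\ preserves bJ (sign_flip x).1,
      admissible d Z bI id be (shifted la (sign_flip x).1) (ent (sign_flip
        x).2),
      ~ lattice_mx bJ (ent (sign_flip x).2), sign_flip (sign_flip x) = x
    & (sign_flip x).1 = ~~ x.1 :> bool].
Proof.
case: x => w M /= pw a nl; set m := ent M.
have supp (N : mx d p q) r j : (q <= j)%N -> ent N r j = 0%N.
  move=> qj; apply/eqP/negPn/negP => /ent_supp/andP[_].
  by rewrite ltnNge qj.
have suppr (N : mx d p q) r j : (p <= r)%N -> ent N r j = 0%N.
  move=> pr; apply/eqP/negPn/negP => /ent_supp/andP[].
  by rewrite ltnNge pr.
have [r [i fv]] := (not_latticeP (supp M)).1 nl.
have [/andP[/eqP bi iq] _ _ _] := fv.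
have iq' : (i < q)%N by apply: ltnW.
pose io := Ordinal iq'; pose jo := Ordinal iq.
have Rm s : link bI s -> interlaced m s by move=> /eqP;
  case: (a) => _ [_ + _] _ _; apply.
pose m' := toggle (link bI) i r (deficit m r i) m.
have [ci cj] := exchange_colsum Rm (suppr M) fv.
rewrite -/m' in ci cj.
have a' : admissible d Z bI id be (shifted la (adj_tperm i * w)%g) m'.
  have cs : rowsums p (tr m) (shifted la w) by case: (a).
  have e1 := cs io; have e2 := cs jo; rewrite /= /shifted /= in e1 e2.
  apply: (admissible_toggle (i := io) (j := jo) _ _ a) => //=.
  - by move=> s; apply: ZJ.
  - exact: deficit_le fv.
  - exact: deficit_cap fv.
  - by move=> l li lj; rewrite /shifted (adj_tpermE (i := io) (j :=
      jo)) // permM tpermD // eq_sym.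
  - rewrite /shifted (adj_tpermE (i := io) (j := jo)) // permM tpermL /= -/m';
      lia.
  - rewrite /shifted (adj_tpermE (i := io) (j :=
      jo)) // permM tpermR /= -/m -/m'; lia.
have eM : ent (mk d p q m') = m' by apply: mkK; case: a'.
have fv' : first_violation link_below m' r i := exchange_first_violation Rm fv.
rewrite /sign_flip /= -/m (violationE fv) /= -/m' eM.
split=> //.
- apply/forallP => l; rewrite (adj_tpermE (i := io) (j := jo)) // permM.
  rewrite (eqP (forallP pw _)); case: tpermP => [->|->|//] /=; by rewrite bi.
- by apply/(not_latticeP _).2; [rewrite -eM; apply: supp|exists r, i].
- rewrite (violationE fv') (exchangeK Rm fv) /m entK.
  by rewrite mulgA (adj_tpermE (i := io) (j := jo)) // tperm2 mul1g.
- rewrite (adj_tpermE (i := io) (j := jo)) // odd_permM odd_tperm.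
  by have -> : io != jo by apply/eqP => /(congr1 val) /=; lia.
Qed.

(** The lattice condition on all the rows bounds the column sums. *)
Lemma lattice_dominant (al : 'I_q -> int) m :
  admissible d Z bI bJ be al m -> dominant bJ al.
Proof.
move=> [_ [_ _ C] _ cs] i j ij bij; rewrite -!cs lez_nat.
have := C i; rewrite -ij bij => /(_ erefl) /(_ p); rewrite -ij psumS.
by apply: leq_trans; apply: leq_addr.
Qed.

Lemma natr_num_mx P : (num_mx d p q P)%:R =
  \sum_(M : mx d p q | `[< P (ent M) >]) 1 :> int.
Proof. by rewrite sumr_const. Qed.

(** In the alternating sum over pairs of a permutation w and a matrix, the
    non-lattice matrices cancel by [sign_flip]. The column sums of a lattice
    matrix are dominant, which forces w = 1. *)
Lemma alternant_num_adm (la : 'I_q -> int) : dominant bJ la ->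
  alternant bJ (fun al => (num_adm d Z bI id be al)%:R) la =
  (num_adm d Z bI bJ be la)%:R.
Proof.
move=> dla; pose lat (M : mx d p q) := `[< lattice_mx bJ (ent M) >].
pose P w (M : mx d p q) := `[< admissible d Z bI id be (shifted la w) (ent M)
  >].
have -> : alternant bJ (fun al => (num_adm d Z bI id be al)%:R) la =
    \sum_(w | preserves bJ w) \sum_(M | P w M && lat M) (-1) ^+ (odd_perm w) +
    \sum_(w | preserves bJ w) \sum_(M | P w M && ~~ lat M) (-1) ^+ (odd_perm w).
  rewrite -big_split; apply: eq_bigr => w _ /=.
  rewrite -bigID natr_num_mx mulr_sumr.
by apply: eq_bigr => M _; exact: mulr1.
have latP w M : P w M && lat M = `[< admissible d Z bI bJ be (shifted la w)
  (ent M) >].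
  apply/andP/asboolP => [[/asboolP a /asboolP l]|].
    by apply/admissible_lattice.
  by move=> /admissible_lattice[a l]; split; apply/asboolP.
rewrite [X in _ + X]pair_big_dep /= [X in _ + X](sum_involution (h :=
  sign_flip)).
  rewrite addr0 (bigD1 1%g) ?preserves1 //= [X in _ + X]big1 ?addr0.
    rewrite odd_perm1 expr0 natr_num_mx; apply: eq_bigl => M.
    by rewrite latP shifted1.
  move=> w /andP[pw w1]; apply: big_pred0 => M; rewrite latP.
  apply/asboolP => /lattice_dominant dw.
  by rewrite (dominant_shifted bJ_mono dla pw dw) eqxx in w1.
case=> w M /= /andP[pw /andP[/asboolP a /asboolP nl]].
have [pw' a' nl' -> sgn] := sign_flipP (x := (w, M)) pw a nl; split=> //.
  by apply/and3P; split; [|apply/asboolP|apply/asboolP].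
by rewrite sgn /=; case: (odd_perm w) => /=; rewrite ?expr0 ?expr1 ?opprK.
Qed.

End SignReversing.

Section Diagonal.

Variables (b : nat -> nat).
Hypothesis b_mono : {homo b : i j / (i <= j)%N}.

(** Going up and left along the diagonal, partial sums grow, and at the
    border of the block they are empty. *)
Lemma interlaced_triangular m :
    (forall r j, m r j != 0%N -> b r = b j) ->
    (forall r, b r = b r.+1 -> interlaced m r) ->
  forall r j, (j < r)%N -> m r j = 0%N.
Proof.
move=> Zm Rm r j jr; have [//|/Zm brj] := eqVneq (m r j) 0%N.
suff H : psum m r j.+1 = 0%N by apply/eqP; move: H; rewrite psumS; lia.
elim: j r jr brj => [|j IH] [//|r]; rewrite !ltnS => jr brj.
  have br : b r = b r.+1 by have := b_mono (leqnSn r);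
    have := b_mono (leq0n r); lia.
  by apply/eqP; rewrite -leqn0; have := Rm r br 0%N; rewrite psum0.
have br : b r = b r.+1 by have := b_mono (leqnSn r); have := b_mono jr; lia.
apply/eqP; rewrite -leqn0; apply: leq_trans (Rm r br j.+1) _.
have [bj|bj] := eqVneq (b j) (b j.+1); first by rewrite IH // br brj.
rewrite leqn0; apply/eqP; rewrite /psum big1 // => i _.
have [//|/Zm bri] := eqVneq (m r i) 0%N.
have := b_mono (leqnSn j); have := b_mono (ltn_ord i : (i <= j)%N); lia.
Qed.

(** The only lattice tableau of a given shape has its row r filled with r+1. *)
Lemma diagonal m :
    (forall r j, m r j != 0%N -> b r = b j) ->
    (forall r, b r = b r.+1 -> interlaced m r) ->
    (forall r, b r = b r.+1 -> interlaced (tr m) r) ->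
  forall r j, r != j -> m r j = 0%N.
Proof.
move=> Zm Rm Cm r j; rewrite neq_ltn => /orP[rj|jr].
  by apply: (interlaced_triangular (m := tr m)) rj => // s l /Zm.
exact: interlaced_triangular jr.
Qed.

End Diagonal.

(** * Expansion into lattice matrices and tableaux *)

Definition bdiag (b : nat -> nat) (r j : nat) : bool := b r == b j.

Section Expansion.

Variable d : nat.

(** The column sums of a matrix of total d have this form ([admissible_wt]),
    so that sums over weights range over a finite type. *)
Definition wt n (nu : {ffun 'I_n -> 'I_d.+1}) : 'I_n -> int :=
  fun i => Posz (nu i).

Lemma num_adm_neq0 p q Z bI bJ (be : 'I_p -> int) (al : 'I_q -> int) :
  num_adm d Z bI bJ be al != 0%N -> exists m, admissible d Z bI bJ be al m.
Proof.
by rewrite -lt0n => /card_gt0P[M /asboolP a]; exists (ent M).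
Qed.

(** The total of the matrix bounds its column sums. *)
Lemma admissible_wt p q Z bI bJ (be : 'I_p -> int) (al : 'I_q -> int) m :
  admissible d Z bI bJ be al m ->
  exists2 nu : {ffun 'I_q -> 'I_d.+1}, al = wt nu & (\sum_i (nu i : nat) = d)%N.
Proof.
move=> [[supp tot] _ _ cs].
have sumE : (\sum_(j < q) psum (tr m) j p = d)%N.
  by rewrite -tot /psum exchange_big.
have le (j : 'I_q) : (psum (tr m) j p < d.+1)%N.
  by rewrite ltnS -sumE (bigD1 j) //= leq_addr.
exists [ffun j => Ordinal (le j)].
  by apply/funext => j; rewrite /wt ffunE -cs.
apply: etrans sumE; apply: eq_bigr => j _; by rewrite ffunE.
Qed.

Section Diag.

Variables (q : nat) (b : nat -> nat).
Hypothesis b_mono : {homo b : i j / (i <= j)%N}.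
Implicit Types nu : {ffun 'I_q -> 'I_d.+1}.

Lemma num_adm_diag_neq nu (la : 'I_q -> int) :
  num_adm d (bdiag b) b b (wt nu) la != 0%N -> la = wt nu.
Proof.
move=> /num_adm_neq0[m [[_ _] [z R C] rs cs]].
have dg := diagonal b_mono (fun r j e => eqP (z r j e)) R C.
apply/funext => i; rewrite -cs -rs; congr Posz.
rewrite /psum; apply: eq_bigr => j _; rewrite /tr.
by have [->//|ji] := eqVneq (j : nat) i; rewrite !dg // eq_sym.
Qed.

Definition diagfun nu (r j : nat) : nat :=
  if r == j then if insub r is Some i then nu i : nat else 0%N else 0%N.

Lemma psum_diagfun nu r j :
  psum (diagfun nu) r j = if (r < j)%N then diagfun nu r r else 0%N.
Proof.
elim: j => [|j IH]; first by rewrite psum0.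
rewrite psumS IH ltnS [in RHS]leq_eqVlt.
have [<-|rj] := eqVneq r j; first by rewrite ltnn.
by rewrite [X in (_ + X)%N](_ : _ = 0%N) ?addn0 // /diagfun (negbTE rj).
Qed.

Lemma diagfunE nu (i : 'I_q) : diagfun nu i i = nu i.
Proof. by rewrite /diagfun eqxx valK. Qed.

Lemma diagfun_interlaced nu r :
  dominant b (wt nu) -> b r = b r.+1 -> interlaced (diagfun nu) r.
Proof.
move=> dn br j; rewrite !psum_diagfun ltnS; case: ltnP => // _.
rewrite {1}/diagfun eqxx; case: insubP => //= i iq ir.
have rq : (r < q)%N by apply: ltnW; rewrite -ir.
rewrite (diagfunE nu (Ordinal rq)) -lez_nat; apply: (dn (Ordinal rq) i) => //.
by rewrite br ir.
Qed.

Lemma diagfun_tr nu : tr (diagfun nu) = diagfun nu.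
Proof.
apply/funext => r; apply/funext => j; rewrite /tr /diagfun eq_sym.
by case: eqP => // ->.
Qed.

Lemma admissible_diagfun nu : dominant b (wt nu) ->
  (\sum_i (nu i : nat) = d)%N ->
  admissible d (bdiag b) b b (wt nu) (wt nu) (diagfun nu).
Proof.
move=> dn sn.
have rs : rowsums q (diagfun nu) (wt nu).
  by move=> i; rewrite psum_diagfun ltn_ord diagfunE.
split=> //; last by rewrite diagfun_tr.
- split; last by rewrite -sn; apply: eq_bigr => i _; have [->] := rs i.
  move=> r j; rewrite /diagfun; have [->|//] := eqVneq r j.
  by case: insubP => // i ->.
- split; [|by move=> r; apply: diagfun_interlaced|].
    by move=> r j; rewrite /diagfun /bdiag; have [->|] := eqVneq r j.
  by move=> r; rewrite diagfun_tr; apply: diagfun_interlaced.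
Qed.

Lemma num_adm_diag_eq nu : dominant b (wt nu) -> (\sum_i (nu i : nat) = d)%N ->
  num_adm d (bdiag b) b b (wt nu) (wt nu) = 1%N.
Proof.
move=> dn sn; have a0 := admissible_diagfun dn sn.
rewrite -(card1 (mk d q q (diagfun nu))); apply: eq_card => M.
rewrite !inE; apply/asboolP/eqP => [[_ [z R C] rs _]|->]; last first.
  by rewrite mkK; case: (a0).
have dg := diagonal b_mono (fun r j e => eqP (z r j e)) R C.
rewrite -(entK M); congr mk; apply/funext => r; apply/funext => j.
have [<-|rj] := eqVneq r j; last by rewrite dg // /diagfun (negbTE rj).
have [rq|qr] := ltnP r q; last first.
  rewrite /diagfun eqxx insubF 1?ltnNge ?qr //.
  by apply/eqP/negPn/negP => /ent_supp; rewrite ltnNge qr.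
rewrite (diagfunE nu (Ordinal rq)).
have [<-] := rs (Ordinal rq); rewrite /psum (bigD1 (Ordinal rq)) //= big1
  ?addn0 //.
by move=> i ir; apply: dg; rewrite eq_sym.
Qed.

End Diag.

Section Main.

Variables (p q : nat) (Z : nat -> nat -> bool) (bI bJ : nat -> nat).
Variable be : 'I_p -> int.
Hypothesis bJ_mono : {homo bJ : i j / (i <= j)%N}.
Hypothesis ZJ : forall r j, (j.+1 < q)%N -> bJ j = bJ j.+1 -> Z r j = Z r j.+1.

Lemma energy_bound p' Z' bI' bJ' (be' : 'I_p' -> int) (al : 'I_q -> int) :
  num_adm d Z' bI' bJ' be' al != 0%N ->
    energy al <= \sum_(i < q) Posz ((d + q) ^ 2).
Proof.
move=> /num_adm_neq0[m /admissible_wt[nu -> _]]; apply: ler_sum => i _;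
  rewrite /wt.
rewrite -[Posz (_ ^ _)]/(Posz (_ * _)) PoszM -expr2 -real_normK ?num_real //.
rewrite ler_pXn2r ?nnegrE //.
have := ltn_ord (nu i); have := ltn_ord i; lia.
Qed.

Lemma bdiagJ r j : bJ j = bJ j.+1 -> bdiag bJ r j = bdiag bJ r j.+1.
Proof. by rewrite /bdiag => ->. Qed.

(** Both sides are symmetric under adjacent transpositions inside the
    blocks, and their alternating sums agree, since those of the block
    diagonal factor are 1 at nu and 0 elsewhere ([num_adm_diag_eq],
    [num_adm_diag_neq]). If bJ has a single block, the block diagonal factor
    counts tableaux of shape nu and content al. *)
Theorem num_adm_expansion (al : 'I_q -> int) :
  (num_adm d Z bI id be al)%:R =
  \sum_(nu : {ffun 'I_q -> 'I_d.+1})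
    (num_adm d Z bI bJ be (wt nu))%:R * (num_adm d (bdiag bJ) bJ id (wt nu)
      al)%:R :> int.
Proof.
pose f (al : 'I_q -> int) := (num_adm d Z bI id be al)%:R -
  \sum_(nu : {ffun 'I_q -> 'I_d.+1})
    (num_adm d Z bI bJ be (wt nu))%:R * (num_adm d (bdiag bJ) bJ id (wt nu)
      al)%:R : int.
apply/eqP; rewrite -subr_eq0; apply/eqP; rewrite -/(f al); move: al.
apply: (@alternant_vanish q bJ bJ_mono f (\sum_(i < q) Posz ((d + q) ^ 2))).
- move=> al i j ij bij; rewrite /f num_adm_tperm //; last first.
    by move=> r; apply: ZJ; rewrite -ij.
  congr (_ - _); apply: eq_bigr => nu _; rewrite num_adm_tperm // => r.
  by rewrite /bdiag -ij bij.
- move=> al; have [e|ne _] := eqVneq (num_adm d Z bI id be al) 0%N; last first.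
    exact: energy_bound ne.
  rewrite /f e add0r oppr_eq0 => /eqP nz.
  suff [nu] : exists nu : {ffun 'I_q ->
    'I_d.+1}, num_adm d (bdiag bJ) bJ id (wt nu) al != 0%N.
    exact: energy_bound.
  apply: contrapT => /forallNP z; apply: nz; apply: big1 => nu _.
  by have /negP/negPn/eqP -> := z nu; rewrite mulr0.
move=> la dla.
(* [alternant] is linear, and is known for both terms of f. *)
have -> : alternant bJ f la = (num_adm d Z bI bJ be la)%:R -
    \sum_(nu : {ffun 'I_q -> 'I_d.+1}) (num_adm d Z bI bJ be (wt nu))%:R *
      (num_adm d (bdiag bJ) bJ bJ (wt nu) la)%:R.
  rewrite -alternant_num_adm // /alternant /f.
  under eq_bigr do rewrite mulrBr; rewrite sumrB; congr (_ - _).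
  under eq_bigr do rewrite mulr_sumr; rewrite exchange_big /=.
  apply: eq_bigr => nu _; rewrite -(@alternant_num_adm _ _ _ _ _ _ _ bJ_mono
    (fun r j _ => @bdiagJ r j)) //.
  by rewrite /alternant mulr_sumr; apply: eq_bigr => w _; rewrite mulrCA.
apply/eqP; rewrite subr_eq0; apply/eqP; symmetry.
have [e|] := eqVneq (num_adm d Z bI bJ be la) 0%N.
  rewrite e; apply: big1 => nu _.
  have [->|/num_adm_diag_neq] := eqVneq (num_adm d (bdiag bJ) bJ bJ (wt nu) la)
    0%N.
    by rewrite mulr0.
  by move=> /(_ bJ_mono) lanu; rewrite -lanu e mul0r.
move=> /num_adm_neq0[m /admissible_wt[nu lanu snu]];
  rewrite lanu (bigD1 nu) //=.
rewrite num_adm_diag_eq // -?lanu // mulr1 big1 ?addr0 // => nu' nn.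
have [->|/num_adm_diag_neq] := eqVneq (num_adm d (bdiag bJ) bJ bJ (wt nu') la)
  0%N.
  by rewrite mulr0.
move=> /(_ bJ_mono); rewrite lanu => e; case/eqP: nn; apply/ffunP => i.
by apply/val_inj; have := congr1 (@^~ i) e; case.
Qed.

End Main.

End Expansion.

(** * Folding the row sums of a product alphabet *)

Definition no_mask (r j : nat) : bool := true.
Definition one_block (r : nat) : nat := 0.

Section PermRows.

Variables (d p q : nat) (be : 'I_p -> int) (al : 'I_q -> int).

Definition perm_rows (s : {perm 'I_p}) m (r j : nat) : nat :=
  if insub r is Some r' then m (s r' : nat) j else 0%N.

Lemma perm_rowsE (s : {perm 'I_p}) m (r : 'I_p) j : perm_rows s m r j =
  m (s r : nat) j.
Proof. by rewrite /perm_rows valK. Qed.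

Lemma admissible_perm_rows (be' : 'I_p ->
  int) (s : {perm 'I_p}) m : admissible d no_mask id id be' al m ->
  admissible d no_mask id id (be' \o s) al (perm_rows s m).
Proof.
move=> [[supp tot] _ rs cs].
have psE (r : 'I_p) j : psum (perm_rows s m) r j = psum m (s r) j.
  by apply: eq_bigr => i _; rewrite perm_rowsE.
split.
- split.
    move=> r j; rewrite /perm_rows; case: insubP =>
      // r' rp <- /supp/andP[_ ->].
    by rewrite ltn_ord.
  rewrite -[RHS]tot [RHS](reindex_perm s) /=.
  by apply: eq_bigr => r _; rewrite psE.
- by split=> // r /n_Sn.
- by move=> r; rewrite psE rs.
- move=> j; rewrite -cs /psum [in RHS](reindex_perm s) /=.
  by congr Posz; apply: eq_bigr => r _; rewrite /tr perm_rowsE.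
Qed.

(** Without conditions on consecutive rows and columns, the rows of the
    matrices can be permuted. *)
Lemma num_adm_perm_rows (s : {perm 'I_p}) :
  num_adm d no_mask id id (be \o s) al = num_adm d no_mask id id be al.
Proof.
have K t m : (forall r j, m r j != 0 -> (r < p) && (j < q))%N ->
    perm_rows t (perm_rows t^-1%g m) = m.
  move=> supp; apply/funext => r; apply/funext => j; rewrite {1}/perm_rows.
  case: insubP => [r' rp <-|]; first by rewrite perm_rowsE permK.
  by move=> nr; have [//|/supp] := eqVneq (m r j) 0%N; rewrite (negbTE nr).
apply: (@num_mx_bij _ _ _ _ _ _ _ (perm_rows s^-1) (perm_rows s)) =>
  [m []//|m []//|m|m] a.
  split; last by apply: K; case: (a) => [[]].
  have := admissible_perm_rows s^-1 a; congr (admissible _ _ _ _ _ _ _).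
  by apply/funext => r; rewrite /= permKV.
split; first exact: admissible_perm_rows.
by rewrite -{2}(invgK s) K //; case: (a) => [[]].
Qed.

End PermRows.

Section Fold.

Variables (d k n : nat).
Hypothesis n_gt0 : (0 < n)%N.

Definition blk (r : nat) : nat := r %/ n.

Lemma blk_mono : {homo blk : i j / (i <= j)%N}.
Proof. by move=> i j; apply: leq_div2r. Qed.

(** The total weight of the letters r that c identifies with j is a j. *)
Definition folds_to (c : nat -> nat) (a : 'I_n -> int) (be : 'I_(k * n) ->
  int) :=
  [forall j : 'I_n, \sum_(r < k * n | c r == j) be r == a j].

Lemma factor_gt0 (r : 'I_(k * n)) : (0 < k)%N.
Proof. by case: (k) r => // -[]. Qed.

Lemma div_factor_lt (r : 'I_(k * n)) : (r %/ k < n)%N.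
Proof. by rewrite ltn_divLR ?(factor_gt0 r) // [(n * k)%N]mulnC ltn_ord. Qed.

Lemma swap_digits_subproof (r : 'I_(k * n)) : (r %% k * n + r %/ k < k * n)%N.
Proof.
have := ltn_pmod r (factor_gt0 r); have := div_factor_lt r; nia.
Qed.

(** The copy i of the variable m has index m * k + i in the repeated
    alphabet, and index i * n + m when the copies are sorted into k blocks. *)
Definition swap_digits (r : 'I_(k * n)) : 'I_(k * n) :=
  Ordinal (swap_digits_subproof r).

Lemma swap_digits_mod r : (swap_digits r %% n = r %/ k)%N.
Proof. by rewrite /= modnMDl modn_small // div_factor_lt. Qed.

Lemma swap_digits_div r : (swap_digits r %/ n = r %% k)%N.
Proof. by rewrite /= divnMDl // divn_small ?addn0 // div_factor_lt. Qed.

Lemma swap_digits_inj : injective swap_digits.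
Proof.
move=> r s e; apply/val_inj => /=.
rewrite (divn_eq r k) (divn_eq s k).
by rewrite -!swap_digits_mod -!swap_digits_div e.
Qed.

Lemma sum_swap_digits (a : 'I_n -> int) (F : ('I_(k * n) -> int) -> int) :
    (forall be, F (be \o perm swap_digits_inj) = F be) ->
  \sum_(be : {ffun 'I_(k * n) -> 'I_d.+1} | folds_to (fun r =>
    r %/ k)%N a (wt be))
     F (wt be) =
  \sum_(be : {ffun 'I_(k * n) -> 'I_d.+1} | folds_to (fun r =>
    r %% n)%N a (wt be))
     F (wt be).
Proof.
move=> FE; set t := perm swap_digits_inj.
pose h (s : {perm 'I_(k * n)}) (be : {ffun 'I_(k * n) -> 'I_d.+1}) :=
  [ffun r => be (s r)].
have hK s : cancel (h s) (h s^-1%g).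
  by move=> be; apply/ffunP => r; rewrite !ffunE permKV.
have wtE be : wt (h t be) = wt be \o t.
  by apply/funext => r; rewrite /wt ffunE.
rewrite (reindex (h t)) /=; last first.
  apply: onW_bij; exists (h t^-1%g) => //.
  by move=> be; rewrite -{1}(invgK t) hK.
apply: eq_big => be; last by rewrite wtE FE.
apply: eq_forallb => j; congr (_ == _).
rewrite [RHS](reindex_perm t) /=; apply: eq_big => r.
  by rewrite /t permE swap_digits_mod.
by rewrite wtE.
Qed.

(** A block diagonal matrix is given by its diagonal blocks, which are
    stacked into a matrix with n columns. *)
Definition unfold_mx m (r j : nat) : nat := m r (blk r * n + j)%N.
Definition spread_mx m (r s : nat) : nat :=
  if blk r == blk s then m r (s %% n)%N else 0%N.

Section UnfoldPsum.

Variable m : nat -> nat -> nat.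
Hypothesis zm : forall r j, m r j != 0%N -> bdiag blk r j.

Lemma psum_unfold r j : psum (unfold_mx m) r j = psum m r (blk r * n + j).
Proof.
elim: j => [|j IH]; last by rewrite addnS !psumS IH.
rewrite psum0 addn0 /psum big1 // => s _.
have [//|/zm/eqP e] := eqVneq (m r s) 0%N.
by have := leq_trunc_div s n; rewrite -/(blk s) -e leqNgt ltn_ord.
Qed.

End UnfoldPsum.

Section SpreadPsum.

Variable m : nat -> nat -> nat.
Hypothesis mn : forall r j, (n <= j)%N -> m r j = 0%N.

Lemma psum_spread r s : psum (spread_mx m) r s = psum m r (s - blk r * n).
Proof.
elim: s => [|s IH]; first by rewrite !psum0.
rewrite psumS IH /spread_mx /blk; have [sl|ls] := ltnP s (r %/ n * n).
  rewrite gtn_eqF ?addn0 ?ltn_divLR //.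
  by have -> : (s.+1 - r %/ n * n = s - r %/ n * n)%N by lia.
rewrite subSn // psumS; congr (_ + _)%N.
have [e|ne] := eqVneq (r %/ n)%N (s %/ n)%N; first by congr m;
  rewrite e {2}(divn_eq s n) addKn.
apply/esym/mn; rewrite leqNgt; apply/negP => lt; case/eqP: ne.
rewrite -[s in RHS](subnKC ls) divnMDl // [((_ - _) %/ _)%N]divn_small // addn0
  //.
Qed.

End SpreadPsum.

(** Block diagonal tuples of tableaux, of shapes nu, whose contents add up
    to a. *)
Definition mult_cond (nu : 'I_(k * n) -> int) (a : 'I_n -> int) m : Prop :=
  [/\ fits d (k * n) (k * n) m, constrained (bdiag blk) blk id m,
    rowsums (k * n) m nu
    & folds_to (fun r => r %% n)%N a (fun s => Posz (psum (tr m) s (k * n)))].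

Lemma sum_num_adm_fold nu a :
  \sum_(al : {ffun 'I_(k * n) -> 'I_d.+1} | folds_to (fun r =>
    r %% n)%N a (wt al))
    (num_adm d (bdiag blk) blk id nu (wt al))%:R =
  (num_mx d (k * n) (k * n) (mult_cond nu a))%:R :> int.
Proof.
under eq_bigr do rewrite natr_num_mx.
rewrite natr_num_mx.
pose cs (M : mx d (k * n) (k * n)) : {ffun 'I_(k * n) -> 'I_d.+1} :=
  [ffun s : 'I_(k * n) => inord (psum (tr (ent M)) s (k * n))].
have csE (M : mx d (k * n) (k * n)) : fits d (k * n) (k * n) (ent M) ->
    wt (cs M) = (fun s : 'I_(k * n) => Posz (psum (tr (ent M)) s (k * n))).
  move=> fM; apply/funext => s; rewrite /wt ffunE inordK //.
  by rewrite ltnS fits_colsum_le.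
rewrite [RHS](partition_big cs (fun al => folds_to (fun r =>
  r %% n)%N a (wt al))) /=.
  apply: eq_bigr => al fal; apply: eq_bigl => M.
  apply/asboolP/andP => [[f w rs c]|[/asboolP[f w rs fo] /eqP e]].
    have e : (fun s : 'I_(k * n) => Posz (psum (tr (ent M)) s (k * n))) = wt al.
      by apply/funext => s; apply: c.
    split; last first.
      apply/eqP/ffunP => s; apply/val_inj.
      by have := csE M f; rewrite e => /(congr1 (@^~ s)) [].
    by apply/asboolP; split=> //; rewrite e.
  by split=> // s; rewrite -e csE.
by move=> M /asboolP[f w rs fo]; rewrite csE.
Qed.

Lemma blkD (r j : nat) : (j < n)%N -> blk (blk r * n + j) = blk r.
Proof. by move=> jn; rewrite /blk divnMDl // [(j %/ n)%N]divn_small // addn0.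
  Qed.

(** Adding up the contents of the tableaux of a tuple amounts to stacking
    their matrices. *)
Lemma num_mx_fold nu a :
  num_mx d (k * n) (k * n) (mult_cond nu a) = num_adm d no_mask blk id nu a.
Proof.
have small r j : (r < k * n)%N -> (j < n)%N -> (blk r * n + j < k * n)%N.
  move=> rk jn; have : (blk r < k)%N by rewrite /blk ltn_divLR.
  nia.
have foldE m (j : 'I_n) : (forall r j, m r j != 0%N -> bdiag blk r j) ->
    \sum_(s < k * n | (s %% n)%N == j) Posz (psum (tr m) s (k * n)) =
    Posz (psum (tr (unfold_mx m)) j (k * n)).
  move=> z; rewrite /psum; under eq_bigr do rewrite (big_morph Posz PoszD
    (erefl 0)).
  rewrite exchange_big (big_morph Posz PoszD (erefl 0)) /=.
  apply: eq_bigr => r _; pose s0 := Ordinal (small r j (ltn_ord r) (ltn_ord j)).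
  rewrite (bigD1 s0) /=; last by rewrite modnMDl modn_small.
  rewrite big1 ?addr0 // => s /andP[/eqP sj ss0]; rewrite /tr.
  have [-> //|/z/eqP e] := eqVneq (m r s) 0%N.
  by case/eqP: ss0; apply/val_inj; rewrite /= {1}(divn_eq s n) sj e.
have unK m : (forall r j, m r j != 0%N -> bdiag blk r j) ->
    spread_mx (unfold_mx m) = m.
  move=> z; apply/funext => r; apply/funext => s; rewrite /spread_mx /unfold_mx.
  case: eqP => [e|ne]; first by rewrite e -divn_eq.
  by have [//|/z/eqP] := eqVneq (m r s) 0%N.
have spK m : (forall r j, (n <= j)%N -> m r j = 0%N) ->
    unfold_mx (spread_mx m) = m.
  move=> mn; apply/funext => r; apply/funext => j;
    rewrite /spread_mx /unfold_mx.
  have [jn|nj] := ltnP j n; first by rewrite blkD // eqxx modnMDl modn_small.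
  rewrite [RHS]mn // /blk divnMDl //; case: eqP => // e.
  by have := nj; rewrite -(divn_gt0 _ n_gt0); move: e; lia.
have spz m r j : spread_mx m r j != 0%N -> bdiag blk r j.
  by rewrite /spread_mx /bdiag; case: ifP.
apply: (@num_mx_bij _ _ _ _ _ _ _ unfold_mx spread_mx) => [m []//|m []//|m|m].
  move=> [[supp tot] [z R _] rs /forallP fo]; split; last exact: unK.
  have mz r s : (k * n <= s)%N -> m r s = 0%N.
    move=> ks; have [//|/supp/andP[_]] := eqVneq (m r s) 0%N.
    by rewrite ltnNge ks.
  have rsE r : (r < k * n)%N -> psum (unfold_mx m) r n = psum m r (k * n).
    move=> rk; rewrite psum_unfold //.
    have le : (blk r * n + n <= k * n)%N.
      have : (blk r < k)%N by rewrite /blk ltn_divLR.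
      nia.
    rewrite [RHS](@psum_stable _ _ (blk r * n + n)%N) // => s ls.
    have [//|/z/eqP e] := eqVneq (m r s) 0%N.
    by move: ls; rewrite -mulSnr leqNgt e /blk ltn_ceil.
  split.
  - split=> [r j nz|]; last by rewrite -tot; apply: eq_bigr => r _; rewrite rsE.
    have /supp/andP[rk _] := nz; rewrite rk /= ltnNge; apply/negP => nj.
    have /eqP := z _ _ nz; rewrite {2}/blk divnMDl // => e.
    by have := nj; rewrite -(divn_gt0 _ n_gt0); move: e; rewrite /blk; lia.
  - split=> [//|r br j|j /n_Sn//]; rewrite !psum_unfold // -br addnS.
    exact: R.
  - by move=> r; rewrite rsE.
  - by move=> j; rewrite -foldE //; apply/eqP/fo.
move=> [[supp tot] [_ R _] rs cs].
have mn r j : (n <= j)%N -> m r j = 0%N.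
  move=> nj; have [//|/supp/andP[_]] := eqVneq (m r j) 0%N.
  by rewrite ltnNge nj.
split; last exact: spK.
have rsE r : (r < k * n)%N -> psum (spread_mx m) r (k * n) = psum m r n.
  move=> rk; rewrite psum_spread // (@psum_stable _ _ n) //; first exact: mn.
  have : (blk r < k)%N by rewrite /blk ltn_divLR.
  nia.
split.
- split=> [r s|]; last by rewrite -tot; apply: eq_bigr => r _; rewrite rsE.
  rewrite /spread_mx; have [e|//] := eqVneq (blk r) (blk s).
  move=> /supp/andP[rk _]; rewrite rk /=.
  rewrite -(ltn_divLR _ _ n_gt0) -[(s %/ n)%N]/(blk s) -e.
  by rewrite /blk ltn_divLR.
- split=> [r s /spz//|r br s|j /n_Sn//]; rewrite !psum_spread // -br.
  have [sb|bs] := ltnP s (blk r * n).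
    by rewrite (_ : (s.+1 - _ = 0)%N) ?psum0 //; apply/eqP; rewrite subn_eq0.
  by rewrite subSn //; apply: R.
- by move=> r; rewrite rsE.
- by apply/forallP => j; rewrite (foldE _ _ (@spz m)) spK // cs.
Qed.

(** The left-hand side is an alternating sum over the column sums, once
    transposed; its terms carry no condition on the rows, so that
    [sum_swap_digits] applies, followed by [num_adm_expansion] for the
    blocks of n letters. The alternating sum in the other factor gives back
    a lattice condition by [alternant_num_adm], and the sum over the
    contents is a number of multi-tableaux by [num_mx_fold]; it is expanded
    by [num_adm_expansion] with a single block. *)
Theorem fold_expansion (la a : 'I_n -> int) : dominant one_block la ->
  \sum_(be : {ffun 'I_(k * n) -> 'I_d.+1} | folds_to (fun r =>
    r %/ k)%N a (wt be))
     (num_adm d no_mask one_block id la (wt be))%:R =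
  \sum_(mu : {ffun 'I_n -> 'I_d.+1})
    (\sum_(nu : {ffun 'I_(k * n) -> 'I_d.+1})
      (num_adm d no_mask blk one_block (wt nu) la)%:R *
      (num_adm d no_mask blk one_block (wt nu) (wt mu))%:R) *
    (num_adm d no_mask one_block id (wt mu) a)%:R :> int.
Proof.
move=> dla.
pose LR (nu : {ffun 'I_(k * n) -> 'I_d.+1}) (x : 'I_n -> int) : int :=
  (num_adm d no_mask blk one_block (wt nu) x)%:R.
(* The Littlewood-Richardson rule is applied last. *)
transitivity (\sum_(nu : {ffun 'I_(k * n) -> 'I_d.+1})
    LR nu la * (num_adm d no_mask blk id (wt nu) a)%:R); last first.
  under eq_bigr => nu _.
    rewrite (@num_adm_expansion _ _ _ _ _ one_block) // mulr_sumr.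
    over.
  rewrite exchange_big /=; apply: eq_bigr => mu _; rewrite mulr_suml.
  by apply: eq_bigr => nu _; rewrite mulrA.
have wm : {homo one_block : i j / (i <= j)%N} by [].
under eq_bigr => be _.
  rewrite num_adm_tr -(@alternant_num_adm _ _ _ _ _ _ _ wm) //.
  over.
rewrite /alternant exchange_big /=.
under eq_bigr => w _.
  rewrite -mulr_sumr (@sum_swap_digits _ (fun x =>
    (num_adm d no_mask id id x _)%:R)).
    rewrite (eq_bigr (fun al => \sum_(nu : {ffun 'I_(k * n) -> 'I_d.+1})
      (num_adm d no_mask blk id (wt nu) (shifted la w))%:R *
      (num_adm d (bdiag blk) blk id (wt nu) (wt al))%:R)); last first.
      move=> al _; rewrite num_adm_tr (@num_adm_expansion _ _ _ _ _ blk _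
        blk_mono) //.
      by apply: eq_bigr => nu _; rewrite num_adm_tr.
    rewrite exchange_big /= mulr_sumr.
    under eq_bigr => nu _ do rewrite -mulr_sumr sum_num_adm_fold num_mx_fold
      mulrA.
    over.
  by move=> be; rewrite num_adm_perm_rows.
rewrite exchange_big /=; apply: eq_bigr => nu _.
rewrite -mulr_suml; congr (_ * _).
by rewrite /LR -(@alternant_num_adm _ _ _ _ _ _ _ wm).
Qed.

End Fold.

(** * Tableaux as matrices *)

Local Open Scope nat_scope.

Definition tmat (t : seq (seq nat)) (r j : nat) : nat :=
  count_mem j.+1 (nth [::] t r).

Lemma count_leq_sum (s : seq nat) j : all (fun x => 0 < x) s ->
  count (fun x => x <= j) s = \sum_(i < j) count_mem i.+1 s.
Proof.
move=> s0; elim: j => [|j IH].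
  rewrite big_ord0; elim: s s0 => //= x s IH /andP[x0 s0].
  by rewrite leqNgt x0 IH.
rewrite big_ord_recr /= -IH -count_predUI [X in _ + X](@eq_count _ _ pred0).
  by rewrite count_pred0 addn0; apply: eq_count => x; rewrite /= leq_eqVlt orbC.
by move=> x /=; case: eqP => [->|]; rewrite ?ltnn ?andbF.
Qed.

Lemma sorted_all_geq x (s : seq nat) : sorted leq (x :: s) -> all (leq x) s.
Proof. by rewrite /= (path_sortedE leq_trans) => /andP[]. Qed.

Lemma sorted_tail x (s : seq nat) : sorted leq (x :: s) -> sorted leq s.
Proof. exact: path_sorted. Qed.

Lemma count_leq0 x j (s : seq nat) : sorted leq (x :: s) -> j < x ->
  count (fun y => y <= j) s = 0.
Proof.
move=> /sorted_all_geq/allP xs jx; apply/eqP; rewrite -leqn0 leqNgt -has_count.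
by apply/hasPn => y /xs xy; rewrite -ltnNge (leq_trans jx).
Qed.

(** In a sorted sequence the entries that are at most j come first. *)
Lemma ltn_count_leq (s : seq nat) c j : sorted leq s ->
  (c < count (fun x => x <= j) s) = (c < size s) && (nth 0 s c <= j).
Proof.
elim: s c => [|x s IH] [|c] //= ss.
  by case: (leqP x j) => // jx; rewrite (count_leq0 ss).
have := IH c (sorted_tail ss); rewrite ltnS; case: (leqP x j) => // jx.
by rewrite (count_leq0 ss jx) !ltn0 => <-.
Qed.

Lemma drop_count_leq (s : seq nat) j : sorted leq s ->
  drop (count (fun x => x <= j) s) s = filter (fun x => j < x) s.
Proof.
elim: s => //= x s IH ss; case: (leqP x j) => jx.
  by rewrite add1n /= IH ?(sorted_tail ss).
rewrite (count_leq0 ss jx) drop0; congr (_ :: _); apply/esym/all_filterP.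
apply/allP => y ys; apply: leq_trans jx _.
exact: (allP (sorted_all_geq ss)).
Qed.

Lemma count_leq_all (s : seq nat) N : all (fun x => x <= N) s ->
  count (fun x => x <= N) s = size s.
Proof. by rewrite all_count => /eqP. Qed.

(** Both sides say that each entry of s which is at most j+1 lies below an
    entry of r which is at most j; for j large, the right-hand side also
    compares the sizes. *)
Lemma aboveP (r s : seq nat) : sorted leq r -> sorted leq s ->
    all (fun x => 0 < x) s ->
  (size s <= size r /\ above r s) <->
  forall j, count (fun x => x <= j.+1) s <= count (fun x => x <= j) r.
Proof.
move=> sr ss s0; split=> [[szs /allP ab] j|H].
  rewrite leqNgt; apply/negP => lt.
  have := lt; rewrite ltn_count_leq // => /andP[cs sj].
  have /ab : count (fun x => x <= j) r \in iota 0 (size s) by rewrite mem_iota.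
  move=> /leq_trans /(_ sj); rewrite ltnS => rj.
  have := ltn_count_leq (count (fun x => x <= j) r) j sr.
  by rewrite ltnn (leq_trans cs szs) rj.
have key c : c < size s -> c < size r /\ nth 0 r c < nth 0 s c.
  move=> cs; have := allP s0 _ (mem_nth 0 cs) => /=.
  case e : (nth 0 s c) => [//|j] _.
  have : c < count (fun x => x <= j.+1) s by rewrite ltn_count_leq // cs e /=.
  by move=> /leq_trans /(_ (H j)); rewrite ltn_count_leq // => /andP[].
split.
  by case: (posnP (size s)) => [->//|s1]; have [] := key (size s).-1; lia.
by apply/allP => c; rewrite mem_iota => /andP[_ /key[]].
Qed.

Section TableauMatrix.

Implicit Types (t : tableau).

Lemma tableau_row t r :
  sorted leq (nth [::] (val t) r) /\ all (fun x => 0 < x) (nth [::] (val t) r).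
Proof.
case: t => t /= /and4P[_ pos srt _].
have [rt|tr] := ltnP r (size t); last by rewrite nth_default.
by split; [apply: (allP srt)|apply: (allP pos)]; apply: mem_nth.
Qed.

Lemma tableau_row_gt0 t r : r < size (val t) -> 0 < size (nth [::] (val t) r).
Proof.
case: t => t /= /and4P[/andP[_ nz] _ _ _] rt; rewrite lt0n.
apply: contraNneq nz => e; apply/mapP; exists (nth [::] t r) => //.
exact: mem_nth.
Qed.

Lemma psum_tmat t r j :
  psum (tmat (val t)) r j = count (fun x => x <= j) (nth [::] (val t) r).
Proof. by rewrite count_leq_sum //; case: (tableau_row t r). Qed.

Lemma tmat_interlaced t r : interlaced (tmat (val t)) r.
Proof.
move=> j; rewrite !psum_tmat; have [s1 p1] := tableau_row t r.
have [s2 p2] := tableau_row t r.+1.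
have [rt|tr] := ltnP r.+1 (size (val t)); last by rewrite (nth_default _ tr).
move: j; apply/aboveP => //; move: (valP t) => /and4P[/andP[sz _] _ _ ab].
split; last exact: (sortedP [::] ab).
have := sortedP 0 sz r; rewrite size_map => /(_ rt).
by rewrite !(nth_map [::]) // ltnW.
Qed.

Lemma psum_tmat_size t r N : (forall j, N <= j -> tmat (val t) r j = 0) ->
  psum (tmat (val t)) r N = size (nth [::] (val t) r).
Proof.
move=> tN; rewrite psum_tmat count_leq_all //; apply/allP => x xr.
have [_ /allP/(_ _ xr)] := tableau_row t r; case: x xr => // j xr _.
rewrite ltnNge; apply/negP => /tN; rewrite /tmat => /eqP.
by rewrite -leqn0 leqNgt -has_count has_pred1 xr.
Qed.

(** A row is the sorted arrangement of its letters, and a tableau has no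
    empty row. *)
Lemma tmat_inj t t' : tmat (val t) = tmat (val t') -> t = t'.
Proof.
move=> e; apply: val_inj => /=.
have row r : nth [::] (val t) r = nth [::] (val t') r.
  have [s1 p1] := tableau_row t r; have [s2 p2] := tableau_row t' r.
  apply: (sorted_eq leq_trans anti_leq) => //.
  apply/allP => -[|j] _ /=; last by apply/eqP;
    apply: (congr2 (fun f r => f r j) e).
  have z s : all (fun x => 0 < x) s -> count_mem 0 s = 0.
    by move=> /allP s0; apply/count_memPn/negP => /s0.
  by rewrite !z.
have size_le (u v : tableau) : (forall r,
  nth [::] (val u) r = nth [::] (val v) r) ->
    size (val u) <= size (val v).
  move=> uv; rewrite leqNgt; apply/negP => /tableau_row_gt0.
  by rewrite uv nth_default.
apply: (@eq_from_nth _ [::]) => [|r _]; last exact: row.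
by apply/eqP; rewrite eqn_leq !size_le.
Qed.

Fixpoint mrow (m : nat -> nat -> nat) r N : seq nat :=
  if N is N'.+1 then mrow m r N' ++ nseq (m r N') N else [::].

Lemma mrow_all m r N : all (fun x => 0 < x <= N) (mrow m r N).
Proof.
elim: N => //= N IH; rewrite all_cat all_nseq leqnn orbT andbT.
by apply: sub_all IH => x /andP[-> /leqW ->].
Qed.

Lemma mrow_sorted m r N : sorted leq (mrow m r N).
Proof.
elim: N => //= N IH; rewrite (sorted_pairwise leq_trans) pairwise_cat.
rewrite -!(sorted_pairwise leq_trans) IH /=; apply/andP; split; last first.
  by elim: (m r N) => // -[|c] //= ->; rewrite leqnn.
apply/allrelP => x y /(allP (mrow_all m r N)) /andP[_ xN].
by rewrite mem_nseq => /andP[_ /eqP ->]; apply: leqW.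
Qed.

Lemma count_mrow m r N j : count_mem j.+1 (mrow m r N) =
  if j < N then m r j else 0.
Proof.
elim: N => //= N IH; rewrite count_cat IH count_nseq /= eqSS ltnS [in
  RHS]leq_eqVlt.
have [->|jN] := eqVneq N j; first by rewrite ltnn mul1n.
by rewrite mul0n addn0.
Qed.

Lemma size_mrow m r N : size (mrow m r N) = psum m r N.
Proof. by elim: N => [|N IH] /=;
  rewrite ?psum0 // size_cat IH size_nseq psumS. Qed.

(** By interlacing the row sums decrease, so the nonempty rows come first
    and form a tableau. *)
Lemma tmat_surj m L N : (forall r j, m r j != 0 -> (r < L) && (j < N)) ->
  (forall r, interlaced m r) -> exists t, tmat (val t) = m.
Proof.
move=> supp Rm.
(* K will be the number of nonempty rows. *)
have exL : exists r, psum m r N == 0.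
  exists L; rewrite /psum big1 // => j _.
  by have [//|/supp] := eqVneq (m L j) 0; rewrite ltnn.
have mN r j : N <= j -> m r j = 0.
  move=> Nj; have [//|/supp/andP[_]] := eqVneq (m r j) 0.
  by rewrite ltnNge Nj.
have mono r : psum m r.+1 N <= psum m r N.
  apply: leq_trans (Rm r N); exact: leq_psum.
case: (ex_minnP exL) => K /eqP K0 Kmin.
have zero r : K <= r -> psum m r N = 0.
  elim: r => [|r IH]; first by rewrite leqn0 => /eqP kk; move: K0; rewrite kk.
  rewrite leq_eqVlt => /predU1P[<- //|/IH e].
  by apply/eqP; rewrite -leqn0 -e mono.
pose t := mkseq (fun r => mrow m r N) K.
have nthK r : r < K -> nth [::] t r = mrow m r N by move=> rK;
  rewrite nth_mkseq.
have ssyt : is_ssyt t.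
  apply/and4P; split.
  - rewrite /is_intpart; apply/andP; split.
      apply/(sortedP 0) => r; rewrite size_map size_mkseq => rK.
      rewrite !(nth_map [::]) ?size_mkseq // 1?ltnW //.
      rewrite !nthK ?(ltnW rK) // !size_mrow; exact: mono.
    apply/negP => /mapP[s /mapP[r]]; rewrite mem_iota /= => rK ->.
    rewrite size_mrow => /esym/eqP/Kmin; by rewrite leqNgt rK.
  - apply/allP => s /mapP[r _ ->]; apply: sub_all (mrow_all m r N).
    by move=> x /andP[].
  - by apply/allP => s /mapP[r _ ->]; apply: mrow_sorted.
  - apply/(sortedP [::]) => r; rewrite size_mkseq => rK.
    rewrite !nthK //; last exact: ltnW.
    have pos s : all (fun x => 0 < x) (mrow m s N).
      by apply: sub_all (mrow_all m s N) => x /andP[].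
    apply: (proj2 (proj2 (aboveP (mrow_sorted _ _ _) (mrow_sorted _ _ _) (pos
      _)) _)).
    have psE s j : count (fun x => x <= j) (mrow m s N) = psum m s j.
      rewrite count_leq_sum //; apply: eq_bigr => i _; rewrite count_mrow.
      by case: ltnP => // /mN ->.
    by move=> j; rewrite !psE; apply: Rm.
exists (exist _ t ssyt); apply/funext => r; apply/funext => j; rewrite /tmat /=.
have [rK|Kr] := ltnP r K.
  by rewrite nthK // count_mrow; case: ltnP => // /mN ->.
rewrite nth_default ?size_mkseq //=; apply/esym; have := zero r Kr.
have [jN|/mN //] := ltnP j N.
by rewrite /psum (bigD1 (Ordinal jN)) //=; lia.
Qed.

End TableauMatrix.

(** * Multi-tableaux as matrices *)

Lemma psum_tr_tmat (R : seq (seq nat)) j r :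
  psum (tr (tmat R)) j r = count_mem j.+1 (flatten (take r R)).
Proof.
elim: r => [|r IH]; first by rewrite psum0 take0.
rewrite psumS IH /tr /tmat; have [rR|Rr] := ltnP r (size R).
  by rewrite (take_nth [::]) // flatten_rcons count_cat.
by rewrite nth_default // addn0 !take_oversize // leqW.
Qed.

(** The lattice condition for the two letters i and i+1. *)
Definition ballot i (w : seq nat) : Prop :=
  forall n, count_mem i.+1 (drop n w) <= count_mem i (drop n w).

(** Among the suffixes of s ++ w that contain w, the most demanding one
    starts where the letters of s exceed i: it contains all the i+1 of s and
    none of its i. *)
Lemma ballot_cat i s w : sorted leq s ->
  ballot i (s ++ w) <->
  ballot i w /\ count_mem i.+1 (s ++ w) <= count_mem i w.
Proof.
move=> ss; split=> [b|[b le] n].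
  split=> [n|]; first by have := b (n + size s);
    rewrite -drop_drop drop_size_cat.
  have := b (count (fun x => x <= i) s).
  rewrite !drop_cat; case: ifP => [_|/negbT]; last first.
    rewrite -leqNgt => szs.
    have /eqP allx : count (fun x => x <= i) s = size s.
      by apply/eqP; rewrite eqn_leq count_size.
    rewrite (eqP allx) subnn drop0 count_cat.
    suff -> : count_mem i.+1 s = 0 by [].
    rewrite -all_count in allx; apply/count_memPn/negP => /(allP allx).
    by rewrite ltnn.
  rewrite drop_count_leq // !count_cat !count_filter.
  rewrite (@eq_count _ (predI (pred1 i.+1) _) (pred1 i.+1)) => [|x /=];
    last first.
    by case: eqP => // ->; rewrite /= ltnSn.
  rewrite (@eq_count _ (predI (pred1 i) _) pred0) ?count_pred0 // => x /=.
  by case: eqP => // ->; rewrite /= ltnn.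
rewrite drop_cat; case: ltnP => // ns.
move: le; rewrite !count_cat => le; apply: leq_trans (leq_addl _ _).
apply: leq_trans le; rewrite leq_add2r.
by rewrite -[in X in _ <= X](cat_take_drop n s) count_cat leq_addl.
Qed.

(** A lattice word is read from its end, hence row by row from the top;
    [ballot_cat] reduces the condition to one inequality for each row. *)
Lemma ballot_rows (R : seq (seq nat)) j : all (sorted leq) R ->
  ballot j.+1 (flatten (rev R)) <-> interlaced (tr (tmat R)) j.
Proof.
elim/last_ind: R => [_|R x IH].
  by split=> // _ r; rewrite !psum_tr_tmat.
rewrite all_rcons => /andP[sx /IH{}IH];
  rewrite rev_rcons /= (ballot_cat _ _ sx).
have cR i : count_mem i (flatten (rev R)) = count_mem i (flatten R).
  by apply/seq.permP; apply: perm_flatten; rewrite perm_rev.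
rewrite IH; have tk r : r <= size R -> take r (rcons R x) = take r R.
  by move=> rR; rewrite -cats1 takel_cat.
have tk' r : size R < r -> take r (rcons R x) = rcons R x.
  by move=> Rr; rewrite take_oversize // size_rcons.
split=> [[H le] r|H].
  rewrite !psum_tr_tmat; have [rR|Rr] := ltnP r (size R).
    by rewrite !tk ?(ltnW rR) // -!psum_tr_tmat; apply: H.
  rewrite tk' // flatten_rcons count_cat addnC; move: le;
    rewrite count_cat !cR addnC.
  move=> /leq_trans; apply.
  move: Rr; rewrite leq_eqVlt => /predU1P[<-|Rr].
    by rewrite tk // take_size.
  by rewrite tk' // flatten_rcons count_cat leq_addr.
(* The condition on the last row of rcons R x, which is row number size R. *)
have Hl : count_mem j.+2 (flatten R) + count_mem j.+2 x <= count_mem j.+1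
  (flatten R).
  have := H (size R); rewrite !psum_tr_tmat tk' // tk // take_size.
  by rewrite flatten_rcons count_cat.
split; last by rewrite count_cat !cR addnC.
move=> r; rewrite !psum_tr_tmat; have [rR|Rr] := ltnP r (size R).
  by have := H r; rewrite !psum_tr_tmat !tk ?(ltnW rR).
rewrite !take_oversize //; last exact: leqW.
by apply: leq_trans Hl; apply: leq_addr.
Qed.

Section Multi.

Variables (k n : nat).
Hypothesis n_gt0 : 0 < n.
Implicit Types (T : k.-tuple tableau).

(** The last component comes first, because lattice words are read from the
    end. *)
Definition components T : seq (seq (seq nat)) := rev (map val T).

(** Empty rows are added for the rows of component b to have indices b * n,
    ..., b * n + n - 1; they change neither the word nor the content. *)
Definition pad (t : seq (seq nat)) : seq (seq nat) :=
  t ++ nseq (n - size t) [::].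

Definition rowlist T : seq (seq nat) := flatten (map pad (components T)).

Definition short T : Prop := forall i, size (val (tnth T i)) <= n.

Lemma nth_pad t i : nth [::] (pad t) i = nth [::] t i.
Proof.
rewrite nth_cat nth_nseq; case: ltnP => // ti.
by rewrite nth_default //; case: ifP.
Qed.

Lemma nth_flatten_uniform (X : Type) (x0 : X) (ss : seq (seq X)) b i :
    all (fun s => size s == n) ss -> i < n ->
  nth x0 (flatten ss) (b * n + i) = nth x0 (nth [::] ss b) i.
Proof.
move=> + lt_in; elim: ss b => [|s ss IH] b /=; first by rewrite !nth_nil.
move=> /andP[/eqP sn uss]; rewrite nth_cat; case: b => [|b] /=;
  first by rewrite sn lt_in.
rewrite mulSn -addnA sn ltnNge leq_addr /= addKn; exact: IH.
Qed.

Lemma is_ssyt_nil : is_ssyt [::].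
Proof. by []. Qed.

(** Out of range the component is the empty tableau, in accordance with the
    vanishing of the matrix. *)
Definition component T (b : nat) : tableau :=
  if insub b is Some b' then tnth T (rev_ord b')
  else exist (fun t => is_ssyt t) [::] is_ssyt_nil.

Lemma componentE T (b : 'I_k) : component T b = tnth T (rev_ord b).
Proof. by rewrite /component valK. Qed.

Lemma nth_components T b : nth [::] (components T) b = val (component T b).
Proof.
rewrite /component /components; case: insubP => [b' _ <-|]; last first.
  by rewrite -leqNgt => kb; rewrite nth_default // size_rev size_map size_tuple.
have bk : val b' < k := ltn_ord (b' : 'I_k).
rewrite nth_rev ?size_map ?size_tuple //.
rewrite (nth_map (tnth T b')); last first.
  by rewrite size_tuple ltn_subrL /= (leq_ltn_trans _ (ltn_ord b')).
by rewrite [in RHS](tnth_nth (tnth T b')).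
Qed.

Section Short.

Variable T : k.-tuple tableau.
Hypothesis sT : short T.

Lemma size_component t : t \in components T -> size t <= n.
Proof.
rewrite mem_rev => /mapP[u uT ->]; have /tnthP[i ->] := uT; exact: sT.
Qed.

Lemma pad_uniform : all (fun s => size s == n) (map pad (components T)).
Proof.
apply/allP => s /mapP[t /size_component tn ->].
by rewrite size_cat size_nseq subnKC.
Qed.

Lemma nth_rowlist b i : i < n ->
  nth [::] (rowlist T) (b * n + i) = nth [::] (nth [::] (components T) b) i.
Proof.
move=> lt_in; rewrite nth_flatten_uniform ?pad_uniform //.
have [bs|sb] := ltnP b (size (components T)).
  by rewrite (nth_map [::]) // nth_pad.
by rewrite !(@nth_default _ _ _ b) ?size_map.
Qed.

Lemma size_flatten_uniform (X : Type) (ss : seq (seq X)) :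
  all (fun s => size s == n) ss -> size (flatten ss) = size ss * n.
Proof.
elim: ss => //= s ss IH /andP[/eqP sn /IH e].
by rewrite size_cat sn e mulSn.
Qed.

Lemma size_rowlist : size (rowlist T) = k * n.
Proof.
rewrite size_flatten_uniform ?pad_uniform //.
by rewrite size_map size_rev size_map size_tuple.
Qed.

Lemma nth_rowlist_div r :
  nth [::] (rowlist T) r = nth [::] (val (component T (r %/ n))) (r %% n).
Proof.
by rewrite {1}(divn_eq r n) nth_rowlist ?ltn_pmod // nth_components.
Qed.

Lemma multi_wordE : multi_word T = flatten (rev (rowlist T)).
Proof.
rewrite /multi_word /rowlist rev_flatten.
have -> : rev [seq rev s | s <- [seq pad t | t <- components T]] =
    [seq rev (pad (val t)) | t <- T].
  by rewrite -!map_rev /components revK -!map_comp; apply: eq_map.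
elim: (tval T) => //= t s ->; rewrite flatten_cat; congr (_ ++ _).
rewrite /pad rev_cat flatten_cat rev_nseq.
by elim: (n - _) => //= c.
Qed.

Definition multi_tmat : nat -> nat -> nat := tmat (rowlist T).

Lemma multi_tmatE r j :
  multi_tmat r j = tmat (val (component T (r %/ n))) (r %% n) j.
Proof. by rewrite /multi_tmat /tmat nth_rowlist_div. Qed.

Lemma psum_multi_tmat r N :
  psum multi_tmat r N = psum (tmat (val (component T (r %/ n)))) (r %% n) N.
Proof. by apply: eq_bigr => j _; rewrite multi_tmatE. Qed.

Lemma latticeP : lattice T <-> forall j, interlaced (tr multi_tmat) j.
Proof.
have srt : all (sorted leq) (rowlist T).
  apply/(all_nthP [::]) => r _; rewrite nth_rowlist_div.
  by case: (tableau_row (component T (r %/ n)) (r %% n)).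
rewrite /lattice multi_wordE; split=> [lat j|R [|j] // r _].
  by apply/(ballot_rows _ srt) => r; apply: lat.
by move: r; apply/(ballot_rows _ srt)/R.
Qed.

Lemma multi_tmat_interlaced r : blk n r = blk n r.+1 -> interlaced multi_tmat r.
Proof.
rewrite /blk => e j; rewrite !psum_multi_tmat -e.
have -> : r.+1 %% n = (r %% n).+1.
  by have := divn_eq r n; have := divn_eq r.+1 n; rewrite -e; lia.
exact: tmat_interlaced.
Qed.

Lemma count_multi_word x :
  count_mem x (multi_word T) = \sum_(i < k) count_mem x (flatten (val (tnth T
    i))).
Proof.
rewrite /multi_word count_flatten sumnE big_map big_map big_tuple.
apply: eq_bigr => i _; apply/seq.permP; apply: perm_flatten.
by rewrite perm_rev.
Qed.

Lemma multi_contentE j : multi_content T j = psum (tr multi_tmat) j (k * n).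
Proof.
rewrite psum_tr_tmat take_oversize ?size_rowlist // -[LHS]count_multi_word.
by rewrite multi_wordE; apply/seq.permP; apply: perm_flatten; rewrite perm_rev.
Qed.

Lemma psum_multi_tmat_size r N : (forall j, N <= j -> multi_tmat r j = 0) ->
  psum multi_tmat r N = size (nth [::] (rowlist T) r).
Proof.
move=> z; rewrite psum_multi_tmat nth_rowlist_div psum_tmat_size // => j.
by rewrite -multi_tmatE; apply: z.
Qed.

End Short.

Lemma intpart_nth_inj (s s' : seq nat) : is_intpart s -> is_intpart s' ->
  (forall i, nth 0 s i = nth 0 s' i) -> s = s'.
Proof.
move=> /andP[_ z] /andP[_ z'] e.
have le (u v : seq nat) : 0 \notin u -> (forall i, nth 0 u i = nth 0 v i) ->
    size u <= size v.
  move=> zu uv; rewrite leqNgt; apply: contra zu => vu.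
  by rewrite -(nth_default 0 (leqnn (size v))) -uv mem_nth.
apply: (@eq_from_nth _ 0) => [|i _]; last exact: e.
by apply/eqP; rewrite eqn_leq !le.
Qed.

Lemma nth_shape (t : tableau) i : nth 0 (Defs.shape t) i =
  size (nth [::] (val t) i).
Proof.
rewrite /Defs.shape; have [it|ti] := ltnP i (size (val t));
  first by rewrite (nth_map [::]).
by rewrite !nth_default ?size_map.
Qed.

Lemma component_row T (i : 'I_k) r : short T -> r < n ->
  nth [::] (rowlist T) (rev_ord i * n + r) = nth [::] (val (tnth T i)) r.
Proof.
move=> sT rn; rewrite nth_rowlist // nth_components componentE.
by rewrite rev_ordK.
Qed.

(** Row sizes determine the shapes, since no part of a shape is zero. *)
Lemma multi_shapeP S T : short S -> short T ->
  multi_shape S = multi_shape T <->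
  forall r, size (nth [::] (rowlist S) r) = size (nth [::] (rowlist T) r).
Proof.
move=> sS sT; split=> [e r|e].
  rewrite !nth_rowlist_div // -!nth_shape; congr nth.
  rewrite /component; case: insub => // b.
  rewrite -!(tnth_map Defs.shape).
  exact: (congr1 (fun u => tnth u (rev_ord b)) e).
apply: eq_from_tnth => i; rewrite !tnth_map.
have ip (t : tableau) : is_intpart (Defs.shape t) by case/and4P: (valP t).
apply: intpart_nth_inj => // r; rewrite !nth_shape.
have [rn|nr] := ltnP r n; first by rewrite -!component_row // e.
by rewrite !nth_default // (leq_trans _ nr).
Qed.

Lemma multi_tmat_inj S T : short S -> short T ->
  multi_tmat S = multi_tmat T -> S = T.
Proof.
move=> sS sT e; apply: eq_from_tnth => i; apply: tmat_inj.
apply/funext => r; apply/funext => j; rewrite /tmat.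
have [rn|nr] := ltnP r n; last by rewrite !nth_default // (leq_trans _ nr).
rewrite -!component_row //; exact: (congr1 (fun f => f _ j) e).
Qed.

(** Each block of rows is the matrix of a tableau by [tmat_surj]. *)
Lemma multi_tmat_surj m N : (forall r j, m r j != 0 ->
  (r < k * n) && (j < N)) ->
    (forall r, blk n r = blk n r.+1 -> interlaced m r) ->
  exists2 T, short T & multi_tmat T = m.
Proof.
move=> supp Rm.
pose part b r j := if r < n then m (b * n + r) j else 0.
have partP b : exists t : tableau, tmat (val t) = part b.
  apply: (@tmat_surj _ n N) => [r j|r j].
    by rewrite /part; case: ifP => //= _ /supp/andP[].
  have [rn|nr] := ltnP r.+1 n; last first.
    by rewrite /psum big1 // => i _; rewrite /part ltnNge nr.
  (* Rows n and beyond of a component are empty: only the inequalities inside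
     the block are needed. *)
  have psE s l : s < n -> psum (part b) s l = psum m (b * n + s) l.
    by move=> sn; apply: eq_bigr => i _; rewrite /part sn.
  rewrite !psE ?(ltnW rn) // addnS; apply: Rm.
  by rewrite -addnS /blk !divnMDl // !divn_small // ltnW.
have [t tP] := choice partP.
pose T := [tuple t (rev_ord i) | i < k].
have sT : short T.
  move=> i; rewrite tnth_mktuple leqNgt; apply/negP => nt.
  have := tableau_row_gt0 nt; have [_ pos] := tableau_row (t (rev_ord i)) n.
  case e : (nth _ _ n) pos => [//|[//|x] s] _ _.
  have := congr1 (fun f => f n x) (tP (rev_ord i)).
  by rewrite /tmat /part ltnn e /= eqxx.
exists T => //; apply/funext => r; apply/funext => j; rewrite multi_tmatE //.
have [rk|kr] := ltnP r (k * n); last first.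
  have [->|/supp/andP[+ _]] := eqVneq (m r j) 0; last by rewrite ltnNge kr.
  rewrite /component insubF ?/tmat ?nth_nil //.
  by apply/negP; rewrite ltn_divLR // ltnNge kr.
have bk : r %/ n < k by rewrite ltn_divLR.
rewrite (componentE _ (Ordinal bk)) tnth_mktuple rev_ordK tP /part.
by rewrite ltn_pmod // -divn_eq.
Qed.

End Multi.

(** * Cardinals of sets of tableaux *)

Local Open Scope classical_set_scope.

Lemma numel_card (T : choiceType) (A : set T) (F : finType) (P : pred F)
    (f : T -> F) :
    {in A &, injective f} -> (forall x, A x -> P (f x)) ->
    (forall y, P y -> exists2 x, A x & f x = y) ->
  finite_set A /\ numel A = #|P|.
Proof.
move=> finj fP fsurj.
have ex (y : {y | P y}) : exists x, A x /\ f x = val y.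
  by have [x Ax fx] := fsurj _ (valP y); exists x.
have [g gP] := choice ex.
pose B := [fset g y | y in predT]%fset.
have AB : A = [set` B].
  apply/seteqP; split=> x /=.
    move=> Ax; pose y : {y | P y} := exist _ (f x) (fP x Ax).
    have [Ag fg] := gP y; apply/imfsetP; exists y => //=.
    by apply: finj; rewrite ?inE //; apply: esym fg.
  by move=> /imfsetP[y _ ->]; case: (gP y).
split; first by rewrite AB; apply: finite_fset.
rewrite /numel AB set_fsetK card_imfset /=; last first.
  by move=> y z e; apply: val_inj; rewrite -(gP y).2 -(gP z).2 e.
by rewrite -cardE card_sig; apply: eq_card.
Qed.

Lemma sum_nth_sumn (s : seq nat) p : size s <= p ->
  \sum_(r < p) nth 0 s r = sumn s.
Proof.
move=> sp; rewrite sumnE (big_nth 0) big_mkord -(subnKC sp) big_split_ord /=.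
rewrite [X in _ + X]big1 ?addn0 // => i _.
by rewrite nth_default // leq_addr.
Qed.

Lemma intpart_size (s : seq nat) : is_intpart s -> size s <= sumn s.
Proof.
move=> /andP[_]; elim: s => //= x s IH; rewrite inE negb_or => /andP[x0 /IH].
by move: x0; lia.
Qed.

Definition seq_wt n (s : seq nat) : 'I_n -> int := fun i => Posz (nth 0 s i).

Section SchurCount.

Variables (p q : nat) (la : intpart) (a : nat -> nat).
Hypothesis lap : size (val la) <= p.
Hypothesis aq : forall j, q <= j -> a j = 0.

Lemma numel_schur :
  numel [set t : tableau | Defs.shape t = val la /\ forall j,
    content t j = a j] =
  num_adm (sumn (val la)) no_mask one_block id (@seq_wt p (val la)) (fun j :
    'I_q => Posz (a j)).
Proof.
set d := sumn _.
have contentE (t : tableau) j : size (val t) <= p ->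
    content t j = psum (tr (tmat (val t))) j p.
  by move=> tp; rewrite psum_tr_tmat take_oversize.
have zero (t : tableau) r j : content t j = 0 -> tmat (val t) r j = 0.
  rewrite /content /tmat => /count_memPn nin; apply/count_memPn.
  apply: contra nin => xr; apply/flattenP; exists (nth [::] (val t) r) => //.
  by apply: mem_nth; rewrite ltnNge; apply/negP => tr;
    rewrite nth_default in xr.
have fwd (t : tableau) : Defs.shape t = val la ->
  (forall j, content t j = a j) ->
    admissible d no_mask one_block id (@seq_wt p (val la)) (fun j : 'I_q =>
      Posz (a j)) (tmat (val t)).
  move=> sh ct.
  have tp : size (val t) <= p by rewrite -(size_map size) -/(Defs.shape t) sh.
  have tq r j : q <= j -> tmat (val t) r j = 0.
    by move=> /aq a0; apply: zero; rewrite ct.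
  have rs r : psum (tmat (val t)) r q = nth 0 (val la) r.
    by rewrite psum_tmat_size -?nth_shape ?sh // => j; apply: tq.
  split.
  - split=> [r j nz|]; last first.
      by rewrite /d -(sum_nth_sumn lap); apply: eq_bigr => r _; rewrite rs.
    rewrite ltnNge [j < q]ltnNge -negb_or; apply/negP => /orP[pr|/tq e].
      by rewrite /tmat nth_default ?(leq_trans tp pr) in nz.
    by rewrite e in nz.
  - split=> // [r _|j /n_Sn //]; exact: tmat_interlaced.
  - by move=> r; rewrite rs.
  - by move=> j; rewrite -contentE // ct.
have [|||_ ->] // := @numel_card _ [set t : tableau | Defs.shape t = val la /\
  forall j, content t j = a j] _ [pred M : mx d p q | `[< admissible d no_mask
    one_block id
    (@seq_wt p (val la)) (fun j : 'I_q => Posz (a j)) (ent M) >]]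
  (fun t => mk d p q (tmat (val t))).
- move=> t t'; rewrite !inE => -[sh ct] [sh' ct'] e; apply: tmat_inj.
  have [f _ _ _] := fwd t sh ct; have [f' _ _ _] := fwd t' sh' ct'.
  by rewrite -(mkK f) e mkK.
- move=> t [sh ct]; apply/asboolP; have a1 := fwd t sh ct.
  by rewrite mkK //; case: a1.
- move=> M /asboolP[[supp tot] [_ R _] rs cs].
  have [t tE] := tmat_surj supp (fun r => R r erefl).
  have tq r j : q <= j -> tmat (val t) r j = 0.
    move=> qj; rewrite tE; have [//|/supp/andP[_]] := eqVneq (ent M r j) 0.
    by rewrite ltnNge qj.
  have tp r : p <= r -> nth [::] (val t) r = [::].
    move=> pr; apply/eqP; rewrite -size_eq0 -(psum_tmat_size (fun j =>
      @tq r j)) tE.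
    rewrite /psum big1 // => j _; have [//|/supp/andP[]] :=
      eqVneq (ent M r j) 0.
    by rewrite ltnNge pr.
  have tp' : size (val t) <= p.
    by rewrite leqNgt; apply/negP => /tableau_row_gt0; rewrite tp.
  exists t; last by rewrite tE entK.
  split.
    apply: intpart_nth_inj; [by case/and4P: (valP t)|exact: valP|move=> r].
    rewrite nth_shape; have [rp|pr] := ltnP r p; last first.
      by rewrite tp // nth_default // (leq_trans lap).
    rewrite -(psum_tmat_size (fun j => @tq r j)) tE.
    by have [->] := rs (Ordinal rp).
  move=> j; have [jq|qj] := ltnP j q.
    by rewrite contentE // tE; have [->] := cs (Ordinal jq).
  rewrite aq // contentE // /psum big1 // => r _; exact: tq.
Qed.

End SchurCount.

Section LatticePairs.

Variables (k n : nat) (la mu : intpart).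
Let d := sumn (val la).
Hypothesis n_gt0 : 0 < n.
Hypothesis dn : d <= n.
Hypothesis mun : size (val mu) <= n.

Lemma multi_word_size (T : k.-tuple tableau) (s : seq nat) :
  (forall j, multi_content T j = nth 0 s j) -> size (multi_word T) = sumn s.
Proof.
move=> ct; have pos : all (fun x => 0 < x) (multi_word T).
  apply/allP => x /flattenP[_ /mapP[t _ ->] /flattenP[r]];
    rewrite mem_rev => rt.
  by case/and4P: (valP t) => _ /allP/(_ r rt)/allP pt _ _; apply: pt.
have cE j : count_mem j.+1 (multi_word T) = nth 0 s j.
  by rewrite -ct count_multi_word.
rewrite -(sum_nth_sumn (leqnn (size s))).
transitivity (\sum_(i < size s) count_mem i.+1 (multi_word T)); last first.
  by apply: eq_bigr => i _.
rewrite -count_leq_sum // count_leq_all //; apply/allP => -[//|j] jw.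
rewrite ltnNge; apply/negP => sj; have := cE j; rewrite nth_default //.
by move/count_memPn; rewrite jw.
Qed.

Lemma multi_word_shape (T : k.-tuple tableau) :
  size (multi_word T) = \sum_(i < k) sumn (Defs.shape (tnth T i)).
Proof.
rewrite /multi_word size_flatten /seq.shape sumnE !big_map big_tuple.
by apply: eq_bigr => i _; rewrite /row_word size_flatten /seq.shape map_rev
  sumn_rev.
Qed.

(** Each row of a tableau contains at least one of the d letters. *)
Lemma word_short (T : k.-tuple tableau) : size (multi_word T) = d -> short n T.
Proof.
move=> sz i; apply: leq_trans dn; rewrite -sz multi_word_shape (bigD1 i) //=.
apply: leq_trans (leq_addr _ _); rewrite -(size_map size) -/(Defs.shape _).
by apply: intpart_size; case/and4P: (valP (tnth T i)).
Qed.

Lemma admissible_multi_tmat (T : k.-tuple tableau) (s : seq nat) :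
    size (multi_word T) = d -> lattice T -> size s <= n ->
    (forall j, multi_content T j = nth 0 s j) ->
  admissible d no_mask (blk n) one_block
    (fun r : 'I_(k * n) => Posz (size (nth [::] (rowlist n T) r)))
    (@seq_wt n s) (multi_tmat n T).
Proof.
move=> sz lt sn ct; have sT := word_short sz.
have rowz r j : k * n <= r -> multi_tmat n T r j = 0.
  by move=> kr; rewrite /multi_tmat /tmat nth_default // size_rowlist.
have cE j : psum (tr (multi_tmat n T)) j (k * n) =
  nth 0 s j by rewrite -multi_contentE.
have colz r j : n <= j -> multi_tmat n T r j = 0.
  move=> nj; have [rk|kr] := ltnP r (k * n); last exact: rowz.
  have := cE j; rewrite nth_default ?(leq_trans sn) // => /eqP.
  by rewrite sum_nat_eq0 => /forallP/(_ (Ordinal rk))/eqP.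
have sd : sumn s = d by rewrite -sz; apply/esym/multi_word_size.
split.
- split=> [r j nz|].
    rewrite ltnNge [j < n]ltnNge -negb_or; apply: contraNN nz.
    by case/orP => [/rowz ->|/colz ->].
  rewrite -sd -(sum_nth_sumn sn) /psum exchange_big /=.
  by apply: eq_bigr => j _; rewrite -cE.
- split=> // [r|j _]; first exact: multi_tmat_interlaced.
  exact: (latticeP n_gt0 sT).1.
- by move=> r; rewrite psum_multi_tmat_size // => j; apply: colz.
- by move=> j; rewrite cE.
Qed.

Lemma admissible_tableaux (nu : 'I_(k * n) -> int) (s : seq nat) m :
    size s <= n -> admissible d no_mask (blk n) one_block nu (@seq_wt n s) m ->
  exists T : k.-tuple tableau,
    [/\ short n T, lattice T, forall j, multi_content T j = nth 0 s j,
        multi_tmat n T = m & forall r, Posz (size (nth [::] (rowlist n T) r)) =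
          if insub r is Some r' then nu r' else 0%R].
Proof.
move=> sn [[supp tot] [_ R C] rs cs].
have [T sT TE] := multi_tmat_surj n_gt0 supp R.
have colz r j : n <= j -> m r j = 0.
  move=> nj; have [//|/supp/andP[_]] := eqVneq (m r j) 0.
  by rewrite ltnNge nj.
exists T; split=> //.
- by apply/(latticeP n_gt0 sT) => j; rewrite TE; apply: C.
- move=> j; rewrite (multi_contentE sT) TE.
  have [jn|nj] := ltnP j n; first by have [->] := cs (Ordinal jn).
  by rewrite nth_default ?(leq_trans sn) // /psum big1 // => r _; apply: colz.
- move=> r; case: insubP => [r' _ <-|].
    rewrite -rs -TE (@psum_multi_tmat_size _ _ n_gt0 _ sT) // => j.
    by rewrite TE; apply: colz.
  by rewrite -leqNgt => kr; rewrite nth_default // size_rowlist.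
Qed.

(** The common row sums nu of the two matrices stand for the common
    multi-shape. *)
Theorem numel_lattice_pairs :
  finite_set (lattice_pairs k la mu) /\
  numel (lattice_pairs k la mu) =
  \sum_(nu : {ffun 'I_(k * n) -> 'I_d.+1})
    num_adm d no_mask (blk n) one_block (wt nu) (@seq_wt n (val la)) *
    num_adm d no_mask (blk n) one_block (wt nu) (@seq_wt n (val mu)).
Proof.
have lan : size (val la) <= n by apply: leq_trans (intpart_size (valP la)) dn.
pose good (nu : 'I_(k * n) -> int) (s : seq nat) :=
  admissible d no_mask (blk n) one_block nu (@seq_wt n s).
pose P (x : mx d (k * n) n * mx d (k * n) n) :=
  `[< exists nu, good nu (val la) (ent x.1) /\ good nu (val mu) (ent x.2) >].
have fwd ST : lattice_pairs k la mu ST -> [/\ short n ST.1, short n ST.2 &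
    exists nu, good nu (val la) (multi_tmat n ST.1) /\ good nu (val mu)
      (multi_tmat n ST.2)].
  case: ST => S T [/= lS lT sh cS cT].
  have szS : size (multi_word S) = d := multi_word_size cS.
  have szT : size (multi_word T) = d.
    rewrite -szS !multi_word_shape; apply: eq_bigr => i _.
    by rewrite -!(tnth_map Defs.shape); congr sumn;
      apply: (congr1 (fun u => tnth u i)).
  have [sS sT] := (word_short szS, word_short szT); split=> //.
  exists (fun r : 'I_(k * n) => Posz (size (nth [::] (rowlist n S) r))).
  split; first exact: admissible_multi_tmat.
  have /(multi_shapeP n_gt0 sS sT) e := sh.
  have -> : (fun r : 'I_(k * n) => Posz (size (nth [::] (rowlist n S) r))) =
      (fun r : 'I_(k * n) => Posz (size (nth [::] (rowlist n T) r))).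
    by apply/funext => r; rewrite e.
  exact: admissible_multi_tmat.
have [|||fin ->] := @numel_card _ (lattice_pairs k la mu) _ P
  (fun ST => (mk d (k * n) n (multi_tmat n ST.1),
    mk d (k * n) n (multi_tmat n ST.2))).
- move=> [S T] [S' T']; rewrite !inE =>
    /fwd[/= sS sT [nu [[f1 _ _ _] [f2 _ _ _]]]].
  move=> /fwd[/= sS' sT' [nu' [[f1' _ _ _] [f2' _ _ _]]]] [e1 e2].
  have -> : S = S' by apply: (multi_tmat_inj sS sS'); rewrite -(mkK f1) e1 mkK.
  by have -> : T = T' by apply: (multi_tmat_inj sT sT');
    rewrite -(mkK f2) e2 mkK.
- move=> [S T] /fwd[_ _ [nu [g1 g2]]]; apply/asboolP; exists nu.
  by rewrite /= !mkK //; [case: g2|case: g1].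
- move=> [M N] /asboolP[nu [/= g1 g2]].
  have [S [sS lS cS SE shS]] := admissible_tableaux lan g1.
  have [T [sT lT cT TE shT]] := admissible_tableaux mun g2.
  exists (S, T) => /=; last by rewrite SE TE !entK.
  split=> //=; apply/(multi_shapeP n_gt0 sS sT) => r.
  by have := shS r; rewrite -shT => -[].
split=> //.
pose rsum (x : mx d (k * n) n * mx d (k * n) n) : {ffun 'I_(k * n) ->
  'I_d.+1} :=
  [ffun r : 'I_(k * n) => inord (psum (ent x.1) r n)].
rewrite -sum1_card (partition_big rsum xpredT) //=; apply: eq_bigr => nu _.
rewrite /num_adm /num_mx -cardX -sum1_card; apply: eq_bigl => -[M N].
apply/andP/andP => /= [[/asboolP[nu' [g1 g2]] /eqP e]|[/asboolP g1 /asboolP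
  g2]].
  have -> : wt nu = nu'; last by split; apply/asboolP.
  case: g1 => /= f _ rs _; apply/funext => r;
    rewrite /wt -e ffunE -rs inordK //.
  by rewrite ltnS (fits_colsum_le r (fits_tr f)).
split; first by apply/asboolP; exists (wt nu).
apply/eqP/ffunP => r; apply/val_inj; case: g1 => /= f _ rs _.
have := rs r; rewrite ffunE => -[->]; rewrite inordK //.
Qed.

End LatticePairs.

(** * The substitution of the repeated alphabet *)

Local Open Scope ring_scope.
Local Open Scope classical_set_scope.

Lemma sum_uniq_supp (V : nmodType) (T : eqType) (r1 r2 : seq T) (F : T -> V) :
    uniq r1 -> uniq r2 -> (forall x, F x != 0 -> (x \in r1) = (x \in r2)) ->
  \sum_(x <- r1) F x = \sum_(x <- r2) F x.
Proof.
move=> u1 u2 e; have drop0 r : \sum_(x <- r) F x = \sum_(x <- r | F x != 0) F x.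
  by rewrite [RHS]big_mkcond; apply: eq_bigr => x _; case: eqP.
rewrite (drop0 r1) (drop0 r2) -!(big_filter _ (fun x => F x != 0)).
apply: perm_big; apply: uniq_perm; rewrite ?filter_uniq // => x.
by rewrite !mem_filter; case: eqP => //= /eqP /e ->.
Qed.

Definition monomial_of (f : nat -> nat) N : monomial :=
  [fsfun x in [fset y | y in iota 0 N]%fset => f x].

Lemma monomial_ofE f N : (forall x, (N <= x)%N -> f x = 0%N) ->
  forall x, monomial_of f N x = f x.
Proof.
move=> fN x; rewrite fsfunE; case: ifPn => // xN; apply/esym/fN.
by rewrite leqNgt; apply: contra xN => xN; apply/imfsetP; exists x;
  rewrite //= mem_iota.
Qed.

Lemma monomial_supp (a : monomial) : exists N, forall x, (N <= x)%N ->
  a x = 0%N.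
Proof.
exists (\max_(x <- finsupp a) x.+1)%N => x; apply: contraTeq.
rewrite -mem_finsupp -ltnNge => xa.
by rewrite (big_rem x) //= leq_max ltnSn.
Qed.

Lemma sum_finsupp (a : monomial) N (Q : pred nat) :
    (forall x, (N <= x)%N -> a x = 0%N) ->
  (\sum_(x <- finsupp a | Q x) a x = \sum_(x < N | Q x) a x)%N.
Proof.
move=> aN; rewrite big_mkcond -(big_mkord Q) [RHS]big_mkcond /=.
apply: sum_uniq_supp; rewrite ?iota_uniq ?fset_uniq // => x.
case: (Q x) => // ax; rewrite mem_finsupp ax mem_index_iota /=.
by apply/esym; rewrite ltnNge; apply: contra ax => /aN ->.
Qed.

Section Fiber.

Variables (k n : nat) (b : monomial).
Hypothesis n_gt0 : (0 < n)%N.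
Hypothesis bn : forall j, (n <= j)%N -> b j = 0%N.

(** For k = 0 both sides say that a and b vanish. *)
Lemma fiberP a : subst_fiber (kfold_alphabet k) b a <->
  (forall x, (k * n <= x)%N -> a x = 0%N) /\
  forall m : 'I_n, b m = (\sum_(x < k * n | (x %/ k)%N == m) a x)%N.
Proof.
rewrite /subst_fiber /kfold_alphabet /=; case: posnP => [->|k_gt0].
  split=> [[a0 bE]|[a0 bE]]; split=> [x _|m]; try exact: a0; rewrite ?a0 //.
    by rewrite bE !big_pred0 // => x; case: x => x; rewrite mul0n.
  rewrite big_pred0 //; have [mn|/bn //] := ltnP m n.
  by rewrite (bE (Ordinal mn)) big_pred0 // => x; case: x => x; rewrite mul0n.
have small x : ((x %/ k < n) = (x < k * n))%N by rewrite ltn_divLR // mulnC.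
split=> [[_ bE]|[a0 bE]].
  have a0 x : (k * n <= x)%N -> a x = 0%N.
    move=> kx; have [//|ax] := eqVneq (a x) 0%N.
    have : (n <= x %/ k)%N by rewrite leqNgt small -leqNgt.
    move=> /bn; rewrite bE (big_rem x) ?mem_finsupp //= eqxx; lia.
  split=> // m; rewrite bE -(sum_finsupp (fun x => (x %/ k)%N == m) a0).
  by apply: eq_bigl => x; apply/eqP/eqP => [[]|->].
split=> // m; rewrite (eq_bigl (fun x => (x %/ k)%N == m)); last first.
  by move=> x; apply/eqP/eqP => [[]|->].
rewrite (sum_finsupp _ a0); have [mn|nm] := ltnP m n.
  by rewrite (bE (Ordinal mn)).
rewrite bn // big_pred0 // => x; apply/negP => /eqP xm.
by have := ltn_ord x; rewrite -small xm ltnNge nm.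
Qed.

End Fiber.

Definition num_schur d p q (la : seq nat) (al : 'I_q -> int) : nat :=
  num_adm d no_mask one_block id (@seq_wt p la) al.

Lemma schurE (K : pzSemiRingType) p q (la : intpart) (a : monomial) :
    (size (val la) <= p)%N -> (forall j, (q <= j)%N -> a j = 0%N) ->
  schur K la a =
  (num_schur (sumn (val la)) p (val la) (fun j : 'I_q => Posz (a j)))%:R.
Proof. by move=> lap aq; rewrite /schur (numel_schur lap aq). Qed.

(** A monomial of the fibre with an exponent greater than the size of la is
    not the content of a tableau of shape la; the others are the weights be. *)
Lemma kappa_schurE (K : pzSemiRingType) k n (la : intpart) (b : monomial) :
    (0 < n)%N -> (size (val la) <= n)%N -> (forall j, (n <= j)%N ->
      b j = 0%N) ->
  kappa k (schur K la) b =
  (\sum_(be : {ffun 'I_(k * n) -> 'I_(sumn (val la)).+1} |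
      folds_to (fun r => r %/ k)%N (fun j : 'I_n => Posz (b j)) (wt be))
    num_schur (sumn (val la)) n (val la) (wt be))%:R.
Proof.
set d := sumn _ => n_gt0 lan bn.
pose ev (be : {ffun 'I_(k * n) -> 'I_d.+1}) (x : nat) : nat :=
  if insub x is Some r then be r : nat else 0%N.
have evE be (r : 'I_(k * n)) : ev be r = be r by rewrite /ev valK.
pose mo be := monomial_of (ev be) (k * n).
have moE be x : mo be x = ev be x.
  apply: monomial_ofE => y ky; rewrite /ev insubF //.
  by apply/negP; rewrite ltnNge ky.
have mo0 be x : (k * n <= x)%N -> mo be x = 0%N.
  by move=> kx; rewrite moE /ev insubF //; apply/negP; rewrite ltnNge kx.
have mo_inj : injective mo.
  move=> be be' e; apply/ffunP => r; apply/val_inj.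
  by rewrite /= -!evE -!moE e.
have moW be : (fun j : 'I_(k * n) => Posz (mo be j)) = wt be.
  by apply/funext => r; rewrite moE evE.
pose P (be : {ffun 'I_(k * n) -> 'I_d.+1}) :=
  folds_to (fun r => r %/ k)%N (fun j : 'I_n => Posz (b j)) (wt be).
have PE be : subst_fiber (kfold_alphabet k) b (mo be) <-> P be.
  rewrite (fiberP _ n_gt0 bn); split=> [[_ bE]|/forallP fo].
    apply/forallP => j; rewrite bE (big_morph Posz PoszD (erefl 0)).
    by apply/eqP; apply: eq_bigr => r _; rewrite moE evE.
  split; first exact: mo0.
  move=> j; have /eqP := fo j; rewrite -(big_morph Posz PoszD (erefl 0)) =>
    -[<-].
  by apply: eq_bigr => r _; rewrite moE evE.
(* The sum over the fibre is restricted to the image of the weights be. *)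
rewrite /kappa /subst (@fsbigE _ _ _ _ _ [seq mo be | be <- enum P]);
  last first.
- move=> a Aa nin; have [_ a0] := (fiberP _ n_gt0 bn a).1 Aa.
  have ak := ((fiberP _ n_gt0 bn a).1 Aa).1.
  rewrite (@schurE _ n (k * n)) // /num_schur -/d.
  have [-> //|/num_adm_neq0[m /admissible_wt[nu aE _]]] :=
    eqVneq (num_adm d no_mask one_block id
    (@seq_wt n (val la)) (fun j : 'I_(k * n) => Posz (a j))) 0%N.
  case/negP: nin; apply/mapP; exists nu.
    rewrite mem_enum; apply/PE.
    suff -> : mo nu = a by [].
    apply/fsfunP => x; have [xk|kx] := ltnP x (k * n); last by rewrite mo0 ?ak.
    have := congr1 (fun f => f (Ordinal xk)) aE; rewrite /wt /= => -[->].
    by rewrite moE (evE _ (Ordinal xk)).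
  apply/fsfunP => x; have [xk|kx] := ltnP x (k * n); last by rewrite mo0 ?ak.
  have := congr1 (fun f => f (Ordinal xk)) aE; rewrite /wt /= => -[->].
  by rewrite moE (evE _ (Ordinal xk)).
- by move=> _ /= /mapP[be + ->]; rewrite mem_enum => /PE.
- by rewrite map_inj_uniq // enum_uniq.
rewrite big_map big_enum_cond /= natr_sum; apply: eq_big => be.
  rewrite andbC; apply/andP/idP => [[]//|Pb]; split=> //.
  by rewrite inE; apply/PE.
move=> _; rewrite (@schurE _ n (k * n)) ?moW //; exact: mo0.
Qed.

(** * Partitions as weights; the expansion *)

Section Partitions.

Variables (d n : nat).
Implicit Types (mu : {ffun 'I_n -> 'I_d.+1}) (la : intpart).

Definition empty_part : intpart := exist (fun s => is_intpart s) [::] isT.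

Definition parts mu : seq nat := [seq (mu i : nat) | i <- enum 'I_n].

(** Meaningful for dominant weights, from which the trailing zeros are
    removed. *)
Definition intpart_of mu : intpart :=
  insubd empty_part [seq x <- parts mu | (0 < x)%N].

Definition ffun_of la : {ffun 'I_n -> 'I_d.+1} :=
  [ffun i : 'I_n => inord (nth 0%N (val la) i)].

Definition is_part_wt mu : bool :=
  `[< dominant one_block (wt mu) >] && (\sum_i (mu i : nat) == d)%N.

Lemma nth_parts mu (i : 'I_n) : nth 0%N (parts mu) i = mu i.
Proof. by rewrite (nth_map i) ?size_enum_ord // nth_ord_enum. Qed.

Lemma size_parts mu : size (parts mu) = n.
Proof. by rewrite size_map size_enum_ord. Qed.

Lemma nth_filter_gt0 (s : seq nat) i : sorted geq s ->
  nth 0%N [seq x <- s | (0 < x)%N] i = nth 0%N s i.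
Proof.
elim: s i => //= x s IH i xs; case: posnP => [x0|_]; last first.
  by case: i => //= i; rewrite IH ?(path_sorted xs).
have s0 : all (fun y => y == 0)%N s.
  have := order_path_min (fun _ _ _ h1 h2 => leq_trans h2 h1) xs.
  by apply: sub_all => y; rewrite x0 leqn0.
rewrite (_ : filter _ _ = [::]) ?nth_nil.
  by case: i => //= i; have /(all_nthP 0%N) z := s0;
    have [/z/eqP->|si] := ltnP i (size s);
    rewrite ?nth_default.
by apply/eqP; rewrite -size_eq0 size_filter -leqn0 leqNgt -has_count;
  apply/hasPn => y /(allP s0)/eqP ->.
Qed.

Lemma parts_sorted mu : dominant one_block (wt mu) -> sorted geq (parts mu).
Proof.
move=> dm; apply/(sortedP 0%N) => i; rewrite size_parts => lt.
have := dm (Ordinal (ltnW lt)) (Ordinal lt) erefl erefl; rewrite /wt lez_nat.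
by rewrite -!nth_parts.
Qed.

Lemma val_intpart_of mu : dominant one_block (wt mu) ->
  val (intpart_of mu) = [seq x <- parts mu | (0 < x)%N].
Proof.
move=> dm; rewrite val_insubd ifT // /is_intpart mem_filter ltnn andbT.
apply: sorted_filter (parts_sorted dm).
by move=> x y z h1 h2; apply: leq_trans h2 h1.
Qed.

Lemma nth_intpart_of mu i : dominant one_block (wt mu) ->
  nth 0%N (val (intpart_of mu)) i = nth 0%N (parts mu) i.
Proof.
by move=> dm; rewrite val_intpart_of // nth_filter_gt0 // parts_sorted.
Qed.

Lemma size_intpart_of mu : dominant one_block (wt mu) ->
  (size (val (intpart_of mu)) <= n)%N.
Proof.
by move=> dm; rewrite val_intpart_of // size_filter -[leqRHS](size_parts mu)
  count_size.
Qed.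

Lemma seq_wt_intpart_of mu : dominant one_block (wt mu) ->
  @seq_wt n (val (intpart_of mu)) = wt mu.
Proof.
by move=> dm; apply/funext => i; rewrite /seq_wt nth_intpart_of // nth_parts.
Qed.

Lemma sumn_intpart_of mu : dominant one_block (wt mu) ->
  sumn (val (intpart_of mu)) = (\sum_i (mu i : nat))%N.
Proof.
move=> dm; rewrite -(sum_nth_sumn (size_intpart_of dm)); apply: eq_bigr => i _.
by rewrite nth_intpart_of // nth_parts.
Qed.

Lemma intpart_of_inj mu mu' : dominant one_block (wt mu) ->
  dominant one_block (wt mu') ->
  intpart_of mu = intpart_of mu' -> mu = mu'.
Proof.
move=> dm dm' e; apply/ffunP => i; apply/val_inj => /=.
by rewrite -!nth_parts -!nth_intpart_of // e.
Qed.

Lemma wt_ffun_of la : (sumn (val la) <= d)%N ->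
  wt (ffun_of la) = @seq_wt n (val la).
Proof.
move=> lad; apply/funext => i; rewrite /wt /seq_wt ffunE inordK // ltnS.
apply: leq_trans lad; rewrite sumnE (big_nth 0%N) big_mkord.
have [il|li] := ltnP i (size (val la)); last by rewrite nth_default.
by rewrite (bigD1 (Ordinal il)) //= leq_addr.
Qed.

Lemma dominant_seq_wt la : dominant one_block (@seq_wt n (val la)).
Proof.
move=> i j ij _; rewrite /seq_wt lez_nat ij.
have [lt|] := ltnP i.+1 (size (val la)); last by move=> ?; rewrite nth_default.
by have /andP[srt _] := valP la; apply: (sortedP 0%N srt).
Qed.

Lemma ffun_ofP la : sumn (val la) = d -> (size (val la) <= n)%N ->
  is_part_wt (ffun_of la) /\ intpart_of (ffun_of la) = la.
Proof.
move=> sd sn; have we := wt_ffun_of (eq_leq sd).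
have dm : dominant one_block (wt (ffun_of la)) by rewrite we;
  apply: dominant_seq_wt.
have ie : intpart_of (ffun_of la) = la.
  apply/val_inj/intpart_nth_inj; [exact: valP|exact: valP|move=> i].
  rewrite nth_intpart_of //; have [lt|ge] := ltnP i n; last first.
    by rewrite !nth_default ?size_parts // (leq_trans sn).
  by have := congr1 (fun f => f (Ordinal lt)) we;
    rewrite /wt /seq_wt -nth_parts => -[].
split=> //; apply/andP; split; first exact/asboolP.
by rewrite -sumn_intpart_of // ie sd.
Qed.

End Partitions.

Section Expansion.

Variables (k : nat) (la : intpart).
Let d := sumn (val la).

(** The two members of a lattice pair have the same shape, hence the same
    number of letters. *)
Lemma numel_pairs_off mu : sumn (val mu) != d ->
  numel (lattice_pairs k la mu) = 0%N.
Proof.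
move=> ne; rewrite (_ : lattice_pairs k la mu = set0).
  by rewrite /numel fset_set0.
apply/seteqP; split=> // -[S T] [/= _ _ sh cS cT]; case/eqP: ne.
rewrite -(multi_word_size cT) /d -(multi_word_size cS) !multi_word_shape.
apply: eq_bigr => i _; rewrite -!(tnth_map Defs.shape); congr sumn.
exact: (congr1 (fun u => tnth u i) (esym sh)).
Qed.

(** A finite set that contains all the partitions of the size of la: such a
    partition has at most d parts, all of them at most d. *)
Definition degree_parts : {fset intpart} :=
  [fset @intpart_of d d mu | mu in predT]%fset.

Lemma mem_degree_parts mu : sumn (val mu) = d -> mu \in degree_parts.
Proof.
move=> sd; have sz : (size (val mu) <= d)%N by rewrite -sd intpart_size ?(valP
  mu).
by apply/imfsetP; exists (ffun_of d d mu); rewrite //= (ffun_ofP sd sz).2.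
Qed.

Definition lr_coefs (K : pzSemiRingType) : {fsfun intpart -> K with 0} :=
  [fsfun mu in degree_parts => (numel (lattice_pairs k la mu))%:R].

Lemma lr_coefsE (K : pzSemiRingType) mu :
  lr_coefs K mu = (numel (lattice_pairs k la mu))%:R.
Proof.
rewrite fsfunE; case: ifPn => // nin; rewrite numel_pairs_off //.
by apply: contra nin => /eqP/mem_degree_parts.
Qed.

(** At a monomial b, all the sums can be taken over weights of length n, for
    n greater than the size of la and than the indices of the variables in
    b. This turns the statement into [fold_expansion]. *)
Theorem kappa_schur_expansion (K : pzSemiRingType) :
  schur_expansion (kappa k (schur K la)) (lr_coefs K).
Proof.
move=> b; have [N bN] := monomial_supp b.
pose n := (maxn d N).+1.
have dn : (d <= n)%N by rewrite leqW // leq_maxl.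
have bn j : (n <= j)%N -> b j = 0%N.
  by move=> nj; apply: bN; apply: leq_trans nj; rewrite leqW // leq_maxr.
have lan : (size (val la) <= n)%N by rewrite (leq_trans _ dn) ?intpart_size
  ?(valP la).
pose bw : 'I_n -> int := fun j => Posz (b j).
rewrite (@kappa_schurE K k n) // -/d.
have -> : (\sum_(be : {ffun 'I_(k * n) -> 'I_d.+1} |
      folds_to (fun r => r %/ k)%N bw (wt be)) num_schur d n (val la) (wt
        be))%N =
    (\sum_(mu : {ffun 'I_n -> 'I_d.+1} | is_part_wt mu)
      numel (lattice_pairs k la (intpart_of mu)) *
      num_schur d n (val (intpart_of mu)) bw)%N.
  apply/eqP; rewrite -(eqr_nat int); apply/eqP; rewrite natr_sum.
  rewrite (@fold_expansion d k n) //; last exact: dominant_seq_wt.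
  rewrite natr_sum [RHS]big_mkcond; apply: eq_bigr => mu _.
  case: ifPn => [/andP[/asboolP dm _]|npl].
    have [_ ->] := @numel_lattice_pairs k n la _ (ltn0Sn _) dn (size_intpart_of
      dm).
    rewrite natrM natr_sum /num_schur seq_wt_intpart_of //; congr (_ * _).
    by apply: eq_bigr => nu _; rewrite natrM.
  rewrite big1 ?mul0r // => nu _.
  have [->|/num_adm_neq0[m a]] := eqVneq (num_adm d no_mask (blk n) one_block
    (wt nu) (wt mu)) 0%N.
    by rewrite mulr0.
  case/negP: npl; apply/andP; split; first by apply/asboolP;
    apply: lattice_dominant a.
  have [mu' e sd] := admissible_wt a; apply/eqP; apply: etrans sd;
    apply: eq_bigr => i _.
  by have := congr1 (fun f => f i) e; rewrite /wt => -[].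
have schurn (mu : intpart) : (size (val mu) <= n)%N ->
    schur K mu b = (num_schur (sumn (val mu)) n (val mu) bw)%:R.
  by move=> mn; rewrite (@schurE K n n).
(* The partitions of d with at most n parts are listed by weights. *)
rewrite natr_sum (@sum_uniq_supp _ _ _ [seq @intpart_of d n mu | mu <- enum
  (@is_part_wt d n)]).
- rewrite big_map big_enum /=; apply: eq_bigr => mu /andP[/asboolP dm /eqP sd].
  by rewrite natrM lr_coefsE schurn ?size_intpart_of // sumn_intpart_of // sd.
- exact: fset_uniq.
- rewrite map_inj_in_uniq ?enum_uniq // => mu mu'; rewrite !mem_enum.
  by move=> /andP[/asboolP dm _] /andP[/asboolP dm' _]; apply: intpart_of_inj.
move=> mu; rewrite mem_finsupp => nz.
have cz : lr_coefs K mu != 0 by apply: contra nz => /eqP ->; rewrite mul0r.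
rewrite cz; apply/esym/mapP.
have sd : sumn (val mu) = d.
  by apply/eqP; apply: contraR cz => /numel_pairs_off e; rewrite lr_coefsE e.
have sn : (size (val mu) <= n)%N by rewrite (leq_trans _ dn) // -sd
  intpart_size ?(valP mu).
by have [pl e] := ffun_ofP sd sn; exists (ffun_of d n mu); rewrite ?mem_enum.
Qed.

End Expansion.

(** * Linear independence of Schur functions *)

Section Triangularity.

(** The classical statistic n(la). *)
Definition nstat (s : seq nat) : nat := \sum_(r < size s) r * nth 0%N s r.

Lemma nstatE s n : (size s <= n)%N ->
  nstat s = (\sum_(r < n) r * nth 0%N s r)%N.
Proof.
move=> sn; rewrite -(subnKC sn) big_split_ord /= [X in (_ + X)%N]big1 ?addn0 //.
by move=> i _; rewrite nth_default ?muln0 // leq_addr.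
Qed.

(** A letter of row r is at least r+1. So replacing each letter by the index
    of its row decreases the total, which goes from the statistic of the
    content mu to that of the shape la; the total is unchanged for the
    diagonal matrix only. *)
Lemma num_schur_triangular d n (la mu : intpart) :
    (size (val la) <= n)%N -> (size (val mu) <= n)%N ->
    num_schur d n (val la) (@seq_wt n (val mu)) != 0%N ->
  (nstat (val la) <= nstat (val mu))%N /\
  (nstat (val la) = nstat (val mu) -> la = mu).
Proof.
move=> lan mun /num_adm_neq0[m [[supp _] [_ R _] rs cs]].
have tri := interlaced_triangular (b := one_block) (fun _ _ _ =>
  leqnn _) (fun _ _ _ => erefl) R.
have row (r : 'I_n) : nth 0%N (val la) r = psum m r n by have [<-] := rs r.
have col (r : 'I_n) : nth 0%N (val mu) r = psum (tr m) r n by have [<-] := cs r.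
have e : nstat (val mu) =
    (nstat (val la) + \sum_(r < n) \sum_(j < n) (j - r) * m r j)%N.
  rewrite !(@nstatE _ n) // -big_split /=.
  under eq_bigr do rewrite col /psum big_distrr.
  rewrite exchange_big /=; apply: eq_bigr => r _.
  rewrite row /psum big_distrr -big_split /=; apply: eq_bigr => j _;
    rewrite /tr.
  have [rj|jr] := leqP r j; first by rewrite -mulnDl subnKC.
  by rewrite tri // !muln0.
split; first by rewrite e leq_addr.
rewrite e => /eqP; rewrite -[X in X == _]addn0 eqn_add2l eq_sym sum_nat_eq0.
move=> /forallP z; have m0 (r j : 'I_n) : r != j :> nat -> m r j = 0%N.
  rewrite neq_ltn => /orP[rj|]; last exact: tri.
  have := z r; rewrite /= sum_nat_eq0 => /forallP/(_ j);
    rewrite /= muln_eq0 subn_eq0.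
  by rewrite leqNgt rj => /eqP.
apply/val_inj/intpart_nth_inj; [exact: valP|exact: valP|move=> i].
have [lt|ge] := ltnP i n; last by rewrite !nth_default // (leq_trans _ ge).
rewrite (row (Ordinal lt)) (col (Ordinal lt)) /psum; apply: eq_bigr => j _.
rewrite /tr; have [<-//|ij] := eqVneq (Ordinal lt) j.
by rewrite (m0 (Ordinal lt) j) // (m0 j (Ordinal lt)) // eq_sym.
Qed.

(** Witnessed by the tableau whose row r is filled with r+1. *)
Lemma num_schur_diag n (la : intpart) : (size (val la) <= n)%N ->
  num_schur (sumn (val la)) n (val la) (@seq_wt n (val la)) != 0%N.
Proof.
move=> lan; set d := sumn _; pose nu := ffun_of d n la.
have we : wt nu = @seq_wt n (val la) := wt_ffun_of n (leqnn d).
have [/andP[/asboolP dm /eqP sd] _] := ffun_ofP (erefl d) lan.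
have [f [_ R _] rs cs] := admissible_diagfun dm sd.
rewrite -lt0n; apply/card_gt0P; exists (mk d n n (diagfun nu)).
by apply/asboolP; rewrite mkK // -we; split=> //; split=> // j /n_Sn.
Qed.

End Triangularity.

(** Among the partitions where c and c' differ, take nu with the least
    statistic [nstat], and compare the coefficients of the monomial y^nu: by
    triangularity no other Schur function with a nonzero coefficient
    contributes. *)
Lemma schur_expansion_uniq (K : numDomainType) (f : series K)
    (c c' : {fsfun intpart -> K with 0}) :
  schur_expansion f c -> schur_expansion f c' -> c = c'.
Proof.
move=> fc fc'; pose X := (finsupp c `|` finsupp c')%fset.
pose e la := c la - c' la.
have cX (g : {fsfun intpart -> K with 0}) a : (finsupp g `<=` X)%fset ->
    \sum_(nu <- finsupp g) g nu * schur K nu a =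
      \sum_(nu <- X) g nu * schur K nu a.
  move=> gX; apply: big_fset_incl => // nu _; rewrite memNfinsupp => /eqP ->.
  by rewrite mul0r.
have rel a : \sum_(nu <- X) e nu * schur K nu a = 0.
  under eq_bigr do rewrite mulrBl; rewrite sumrB -!cX ?fsubsetUl ?fsubsetUr //.
  by rewrite -fc -fc' subrr.
apply/fsfunP => la; apply/eqP; rewrite -subr_eq0 -/(e la);
  apply/negPn/negP => la0.
have eX nu : e nu != 0 -> nu \in X.
  apply: contraR; rewrite in_fsetU negb_or !memNfinsupp /e =>
    /andP[/eqP-> /eqP->].
  by rewrite subrr.
pose P v := has (fun nu => (e nu != 0) && (nstat (val nu) == v)) X.
have exP : exists v, P v.
  by exists (nstat (val la)); apply/hasP; exists la; rewrite ?eX ?la0 ?eqxx.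
case: (ex_minnP exP) => v /hasP[nu nuX /andP[nu0 /eqP nuv]] vmin.
pose a := monomial_of (nth 0%N (val nu)) (size (val nu)).
have aE j : a j = nth 0%N (val nu) j.
  by apply: monomial_ofE => x; apply: nth_default.
have schurn (mu : intpart) : exists n, [/\ (size (val mu) <= n)%N,
  (size (val nu) <= n)%N &
    schur K mu a = (num_schur (sumn (val mu)) n (val mu) (@seq_wt n (val
      nu)))%:R].
  exists (maxn (size (val mu)) (size (val nu))); rewrite leq_maxl leq_maxr;
    split=> //.
  set n := maxn _ _; rewrite (@schurE K n n) ?leq_maxl //.
    by congr (num_schur _ _ _ _)%:R; apply/funext => j; rewrite aE.
  by move=> j; rewrite aE geq_max => /andP[_ ?]; rewrite nth_default.
have := rel a; rewrite (big_rem nu) //= big_seq big1 ?addr0 => [/eqP|mu].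
  rewrite mulf_eq0 (negbTE nu0) /=; have [n [_ nn ->]] := schurn nu.
  by rewrite pnatr_eq0 (negbTE (num_schur_diag nn)).
rewrite mem_rem_uniq ?fset_uniq // inE => /andP[munu muX].
have [->|mu0] := eqVneq (e mu) 0; first by rewrite mul0r.
have [n [mn nn ->]] := schurn mu.
have [->|/(num_schur_triangular mn nn)[le eq]] :=
  eqVneq (num_schur (sumn (val mu)) n (val mu) (@seq_wt n (val nu))) 0%N.
  by rewrite mulr0.
case/eqP: munu; apply: eq; apply/eqP; rewrite eqn_leq le nuv vmin //.
by apply/hasP; exists mu; rewrite // mu0 eqxx.
Qed.

Theorem proposition1p4 (R : realType) (la mu : intpart) (k : nat) :
  exists c : {fsfun intpart -> R[i] with 0},
    [/\ unique (schur_expansion (kappa k (schur R[i] la))) c,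
        finite_set (lattice_pairs k la mu)
      & c mu = (numel (lattice_pairs k la mu))%:R].
Proof.
exists (lr_coefs k la R[i]); split; last exact: lr_coefsE.
  split; first exact: kappa_schur_expansion.
  by move=> c'; apply: schur_expansion_uniq; apply: kappa_schur_expansion.
pose n := (maxn (sumn (val la)) (size (val mu))).+1.
have dn : (sumn (val la) <= n)%N by rewrite leqW // leq_maxl.
have mn : (size (val mu) <= n)%N by rewrite leqW // leq_maxr.
by have [] := @numel_lattice_pairs k n la mu (ltn0Sn _) dn mn.
Qed.
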